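(* Let $n$ be a fixed odd number and $x=x_0+\underline{x}\in\mathbb{R}^{n+1}$. Then $$COS(x)\odot_{GCK}COS(x)+SIN(x)\odot_{GCK}SIN(x)=\gamma_n^2$$ and $$COSH(x)\odot_{GCK}COSH(x)-SINH(x)\odot_{GCK}SINH(x)=\gamma_n^2,$$ where $\gamma_n:=\frac{(-1)^{\frac{n-1}{2}}2^{n-1}}{(n-1)!}\left[\Gamma\left(\frac{n+1}{2}\right)\right]^2$.
   Context: $\mathbb{R}_n$ is the real Clifford algebra generated by $e_1,\dots,e_n$ with $e_\ell e_m+e_me_\ell=0$ for $\ell\ne m$ and $e_\ell^2=-1$. A point $(x_0,\dots,x_n)\in\mathbb{R}^{n+1}$ is identified with the paravector $x=x_0+\underline{x}$, $\underline{x}=\sum_{\ell=1}^n x_\ell e_\ell$. $\Delta_{\mathbb{R}^{n+1}}=\sum_{i=0}^n\partial_{x_i}^2$. A function $f$ on an axially symmetric slice domain (e.g. $\mathbb{R}^{n+1}$) is axially monogenic if it is $C^1$, satisfies $\left(\partial_{x_0}+\sum_{i=1}^n e_i\partial_{x_i}\right)f=0$, and has the form $f(x_0+\underline{x})=A(x_0,|\underline{x}|)+\frac{\underline{x}}{|\underline{x}|}B(x_0,|\underline{x}|)$ with $\mathbb{R}_n$-valued $A,B$ such that $A$ is even and $B$ is odd in the second variable. For an $\mathbb{R}_n$-valued real-analytic function $f_0$ on an open set of $\mathbb{R}$, $GCK[f_0]$ denotes its generalized CK-extension: the unique axially monogenic function (on an axially symmetric slice neighbourhood of the domain of $f_0$)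 of the form $\sum_{j\ge0}\underline{x}^jf_j(x_0)$ whose restriction to the real line is $f_0$. For axially monogenic $A,B$, the generalized CK-product is $A(x_0,\underline{x})\odot_{GCK}B(x_0,\underline{x}):=GCK[A(x_0,0)\cdot B(x_0,0)]$. With $\sinh,\cosh,\sin,\cos$ of a paravector $x$ defined by their usual power series in $\mathbb{R}_n$, set $SINH(x):=\Delta_{\mathbb{R}^{n+1}}^{\frac{n-1}{2}}(\sinh(x))$, $COSH(x):=\Delta_{\mathbb{R}^{n+1}}^{\frac{n-1}{2}}(\cosh(x))$, $SIN(x):=\Delta_{\mathbb{R}^{n+1}}^{\frac{n-1}{2}}(\sin(x))$, $COS(x):=\Delta_{\mathbb{R}^{n+1}}^{\frac{n-1}{2}}(\cos(x))$; these are axially monogenic on $\mathbb{R}^{n+1}$. *)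

(* Defs.v *)
From HB Require Import structures.
From mathcomp Require Import all_boot all_order all_algebra.
From mathcomp Require Import all_classical all_reals all_analysis.

Set Implicit Arguments.
Unset Strict Implicit.
Unset Printing Implicit Defensive.

Import Order.TTheory GRing.Theory Num.Theory.
Import numFieldNormedType.Exports.

Local Open Scope ring_scope.

(** * The real Clifford algebra R_n

    R_n has the basis (e_A) indexed by the subsets A = {i_1 < ... < i_k} of
    the set of generators, where e_A = e_{i_1} ... e_{i_k} (lemma
    [cl_basis_prod]). Generators are numbered from 0, so the e_l of the
    literature is [cl_gen n l.-1]. *)

Definition clifford (R : realType) (n : nat) : Type := 'rV[R]_#|{set 'I_n}|.

(* The (max-)norm is only there for its topology, that of a finite-dimensional
   real vector space. *)
HB.instance Definition _ (R : realType) (n : nat) :=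
  NormedModule.on (clifford R n).
HB.instance Definition _ (R : realType) (n : nat) :=
  Complete.on (clifford R n).

Section CliffordAlgebra.
Variables (R : realType) (n : nat).
Local Notation C := (clifford R n).
Implicit Types (A B D : {set 'I_n}) (x y z : C) (i j : 'I_n).

Definition cl_basis A : C := delta_mx ord0 (enum_rank A).
Definition cl_coef x A : R := (x : 'rV[R]_#|{set 'I_n}|) ord0 (enum_rank A).

Definition symdiff A B : {set 'I_n} := (A :\: B) :|: (B :\: A).

(* Sorting the word e_A e_B into +- e_(symdiff A B) costs a sign for each pair
   i in A, j in B with j < i (anticommutation) or j = i (e_i ^ 2 = -1). *)
Definition cl_sign A B : R :=
  \prod_(i in A) \prod_(j in B) (-1) ^+ (j <= i)%N.

Definition cl_mul x y : C :=
  \sum_A \sum_B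
    (cl_coef x A * cl_coef y B * cl_sign A B) *: cl_basis (symdiff A B).

Definition cl_one : C := cl_basis finset.set0.

Lemma cl_coefD A x y : cl_coef (x + y) A = cl_coef x A + cl_coef y A.
Proof. by rewrite /cl_coef mxE. Qed.

Lemma cl_coefZ A a x : cl_coef (a *: x) A = a * cl_coef x A.
Proof. by rewrite /cl_coef mxE. Qed.

Lemma cl_coef_basis A B : cl_coef (cl_basis A) B = (A == B)%:R.
Proof.
by rewrite /cl_coef mxE eqxx /= (inj_eq enum_rank_inj) eq_sym.
Qed.

Lemma cl_basisE x : x = \sum_A cl_coef x A *: cl_basis A.
Proof.
rewrite {1}[x](row_sum_delta (x : 'rV[R]_#|{set 'I_n}|)).
rewrite (reindex (@enum_rank {set 'I_n})) //=.
by exists enum_val => A _; [exact: enum_rankK | exact: enum_valK].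
Qed.

Lemma cl_mulDl : left_distributive cl_mul +%R.
Proof.
move=> x y z; rewrite /cl_mul -big_split; apply: eq_bigr => A _ /=.
rewrite -big_split; apply: eq_bigr => B _ /=.
by rewrite cl_coefD !mulrDl scalerDl.
Qed.

Lemma cl_mulDr : right_distributive cl_mul +%R.
Proof.
move=> x y z; rewrite /cl_mul -big_split; apply: eq_bigr => A _ /=.
rewrite -big_split; apply: eq_bigr => B _ /=.
by rewrite cl_coefD mulrDr mulrDl scalerDl.
Qed.

Lemma cl_mulZl a x y : cl_mul (a *: x) y = a *: cl_mul x y.
Proof.
rewrite /cl_mul scaler_sumr; apply: eq_bigr => A _ /=.
rewrite scaler_sumr; apply: eq_bigr => B _ /=.
by rewrite cl_coefZ -!mulrA -scalerA !mulrA.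
Qed.

Lemma cl_mulZr a x y : cl_mul x (a *: y) = a *: cl_mul x y.
Proof.
rewrite /cl_mul scaler_sumr; apply: eq_bigr => A _ /=.
rewrite scaler_sumr; apply: eq_bigr => B _ /=.
by rewrite cl_coefZ [cl_coef x A * _]mulrCA -!mulrA -scalerA !mulrA.
Qed.

Lemma cl_mul_suml I (r : seq I) (F : I -> C) y :
  cl_mul (\sum_(i <- r) F i) y = \sum_(i <- r) cl_mul (F i) y.
Proof.
elim: r => [|i r IH]; last by rewrite !big_cons cl_mulDl IH.
by rewrite !big_nil -[X in cl_mul X](scale0r (0 : C)) cl_mulZl scale0r.
Qed.

Lemma cl_mul_sumr I (r : seq I) (F : I -> C) x :
  cl_mul x (\sum_(i <- r) F i) = \sum_(i <- r) cl_mul x (F i).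
Proof.
elim: r => [|i r IH]; last by rewrite !big_cons cl_mulDr IH.
by rewrite !big_nil -[X in cl_mul _ X](scale0r (0 : C)) cl_mulZr scale0r.
Qed.

Lemma cl_mul_basis A B :
  cl_mul (cl_basis A) (cl_basis B) = cl_sign A B *: cl_basis (symdiff A B).
Proof.
rewrite /cl_mul (bigD1 A) //= [X in _ + X]big1 ?addr0 => [|D DA]; last first.
  by apply: big1 => E _; rewrite cl_coef_basis eq_sym (negPf DA) !mul0r scale0r.
rewrite (bigD1 B) //= [X in _ + X]big1 ?addr0 => [|D DB]; last first.
  by rewrite !cl_coef_basis [B == D]eq_sym (negPf DB) mulr0 mul0r scale0r.
by rewrite !cl_coef_basis !eqxx !mul1r.
Qed.

Lemma in_symdiff A B i : (i \in symdiff A B) = (i \in A) (+) (i \in B).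
Proof. by rewrite !inE; case: (i \in A); case: (i \in B). Qed.

Lemma symdiffA : associative symdiff.
Proof. by move=> A B D; apply/setP => i; rewrite !in_symdiff addbA. Qed.

Lemma symdiffC : commutative symdiff.
Proof. by move=> A B; apply/setP => i; rewrite !in_symdiff addbC. Qed.

Lemma prod_symdiff (F : 'I_n -> R) A B : (forall i, F i ^+ 2 = 1) ->
  \prod_(i in symdiff A B) F i = \prod_(i in A) F i * \prod_(i in B) F i.
Proof.
move=> F2; rewrite ![\prod_(i in _) _]big_mkcond -big_split.
apply: eq_bigr => i _ /=; rewrite in_symdiff.
by case: (i \in A); case: (i \in B); rewrite ?mul1r ?mulr1 //= -expr2 F2.
Qed.

Lemma cl_sign_symdiffl A B D :
  cl_sign (symdiff A B) D = cl_sign A D * cl_sign B D.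
Proof.
apply: prod_symdiff => i; rewrite -prodrXl big1 // => j _.
by rewrite -exprM mulnC exprM sqrrN !expr1n.
Qed.

Lemma cl_sign_symdiffr A B D :
  cl_sign A (symdiff B D) = cl_sign A B * cl_sign A D.
Proof.
rewrite /cl_sign -big_split; apply: eq_bigr => i _ /=.
by apply: prod_symdiff => j; rewrite -exprM mulnC exprM sqrrN !expr1n.
Qed.

Lemma cl_mulA : associative cl_mul.
Proof.
move: cl_mul (@cl_mul_suml {set 'I_n}) (@cl_mul_sumr {set 'I_n}) cl_mulZl
  cl_mulZr cl_mul_basis => mul suml sumr mulZl mulZr mulE x y z.
rewrite [x]cl_basisE [y]cl_basisE [z]cl_basisE.
rewrite !suml; apply: eq_bigr => A _; rewrite !sumr.
under [RHS]eq_bigr => D _ do rewrite suml.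
rewrite [RHS]exchange_big; apply: eq_bigr => B _.
rewrite !sumr; apply: eq_bigr => D _.
rewrite !(mulZl, mulZr, mulE) !scalerA symdiffA.
rewrite cl_sign_symdiffl cl_sign_symdiffr; congr (_ *: _).
rewrite -!mulrA [RHS]mulrCA; congr (_ * _); rewrite [RHS]mulrCA; congr (_ * _).
by congr (_ * _); rewrite mulrC mulrA.
Qed.

Lemma cl_mul1l : left_id cl_one cl_mul.
Proof.
move=> x; rewrite [x in LHS]cl_basisE [RHS]cl_basisE cl_mul_sumr.
apply: eq_bigr => A _; rewrite cl_mulZr cl_mul_basis /cl_sign finset.big_set0 scale1r.
by congr (_ *: cl_basis _); apply/setP => i; rewrite in_symdiff inE.
Qed.

Lemma cl_mul1r : right_id cl_one cl_mul.
Proof.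
move=> x; rewrite [x in LHS]cl_basisE [RHS]cl_basisE cl_mul_suml.
apply: eq_bigr => A _; rewrite cl_mulZl cl_mul_basis /cl_sign big1 ?scale1r.
  by congr (_ *: cl_basis _); apply/setP => i; rewrite in_symdiff inE addbF.
by move=> i _; rewrite finset.big_set0.
Qed.

Lemma cl_one_neq0 : cl_one != 0.
Proof.
apply/eqP => /(congr1 (fun x => cl_coef x finset.set0)) /eqP.
by rewrite cl_coef_basis eqxx /cl_coef mxE oner_eq0.
Qed.

HB.instance Definition _ := GRing.Zmodule_isNzRing.Build C
  cl_mulA cl_mul1l cl_mul1r cl_mulDl cl_mulDr cl_one_neq0.

Lemma cl_scalerAl a x y : a *: (x * y) = a *: x * y.
Proof. exact/esym/cl_mulZl. Qed.

HB.instance Definition _ := GRing.Lmodule_isLalgebra.Build R C cl_scalerAl.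

Lemma cl_scalerAr a x y : a *: (x * y) = x * (a *: y).
Proof. exact/esym/cl_mulZr. Qed.

HB.instance Definition _ := GRing.Lalgebra_isAlgebra.Build R C cl_scalerAr.

Definition cl_gen i : C := cl_basis [set i].

Lemma cl_gen_sqr i : cl_gen i * cl_gen i = -1.
Proof.
rewrite [LHS]cl_mul_basis /cl_sign !finset.big_set1 leqnn expr1 scaleN1r.
by congr (- cl_basis _); apply/setP => j; rewrite in_symdiff addbb inE.
Qed.

Lemma cl_gen_anticomm i j : i != j ->
  cl_gen i * cl_gen j + cl_gen j * cl_gen i = 0.
Proof.
move=> ij; have := cl_mul_basis [set i] [set j].
have := cl_mul_basis [set j] [set i]; rewrite symdiffC.
rewrite /cl_sign !finset.big_set1 => e1 e2.
rewrite /GRing.mul /= /cl_gen e1 e2 -scalerDl.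
have : (i : nat) != j by [].
by case: ltngtP => _ // _; rewrite ?(expr0, expr1, addNr, subrr) scale0r.
Qed.

Lemma cl_basis_prod A : cl_basis A = \prod_(i <- enum A) cl_gen i.
Proof.
have sortedP (s : seq 'I_n) : sorted (relpre (@nat_of_ord n) ltn) s ->
    cl_basis [set i in s]%SET = \prod_(i <- s) cl_gen i.
  elim: s => [_|i s IH /=].
    by rewrite big_nil; congr cl_basis; apply/setP => i; rewrite !inE.
  rewrite path_sortedE => [/andP[/allP lt_is /IH ih]|? ? ?]; last exact: ltn_trans.
  rewrite big_cons -ih [RHS]cl_mul_basis /cl_sign finset.big_set1 big1 ?scale1r.
    congr cl_basis; apply/setP => j; rewrite in_symdiff !inE.
    by case: eqVneq => //= ->; apply/esym/negP => /lt_is /=; rewrite ltnn.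
  by move=> j; rewrite inE => /lt_is /= ij; rewrite leqNgt ij.
rewrite -sortedP; first by congr cl_basis; apply/setP => i; rewrite inE mem_enum.
rewrite /enum_mem; apply: sorted_filter => [? ? ?|]; first exact: ltn_trans.
by rewrite -sorted_map -enumT val_enum_ord iota_ltn_sorted.
Qed.

End CliffordAlgebra.

Arguments cl_gen {R n} i.

(** * Paravectors and differential operators

    A point of R^(n+1) is a row vector x; its real part is the coordinate
    [x 0 0] and its l-th vector coordinate is [x 0 (lift ord0 l)]. *)

Local Open Scope classical_set_scope.

Section Clifford_analysis.
Variables (R : realType) (n : nat).
Local Notation C := (clifford R n).
Local Notation E := 'rV[R]_n.+1.
Implicit Types (x : E) (F : E -> C).

Definition scpart x : R := x ord0 ord0.
Definition vecpart x : C := \sum_(i < n) x ord0 (lift ord0 i) *: cl_gen i.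
Definition paravector x : C := (scpart x)%:A + vecpart x.

(* the Euclidean norm of the vector part *)
Definition vecnorm x : R := Num.sqrt (\sum_(i < n) x ord0 (lift ord0 i) ^+ 2).

Definition realpoint (t : R) : E := t *: delta_mx ord0 ord0.

Definition partial (i : 'I_n.+1) F : E -> C :=
  fun x => 'D_(delta_mx ord0 i) F x.

Definition laplacian F : E -> C :=
  fun x => \sum_(i < n.+1) partial i (partial i F) x.

Definition cauchy_riemann F : E -> C :=
  fun x => partial ord0 F x + \sum_(i < n) cl_gen i * partial (lift ord0 i) F x.

Definition C1_on (Om : set E) F : Prop :=
  forall (i : 'I_n.+1) x, Om x ->
    derivable F x (delta_mx ord0 i) /\ {for x, continuous (partial i F)}.

(** * Axially monogenic functions and the generalized CK-extension *)

(* At the points with [vecnorm x = 0] the second term of the axial form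
   vanishes, as it should since the profile B is odd in r. The profiles are
   total functions; their values off the domain are irrelevant. *)
Definition axial_form (Om : set E) F : Prop :=
  exists A B : R -> R -> C,
    [/\ forall t r, A t (- r) = A t r,
        forall t r, B t (- r) = - B t r &
        forall x, Om x ->
          F x = A (scpart x) (vecnorm x) +
                ((vecnorm x)^-1 *: vecpart x) * B (scpart x) (vecnorm x)].

Definition axially_monogenic (Om : set E) F : Prop :=
  [/\ C1_on Om F,
      forall x, Om x -> cauchy_riemann F x = 0 &
      axial_form Om F].

Definition is_gck (Om : set E) (f0 : R -> C) F : Prop :=
  [/\ axially_monogenic Om F,
      exists f : nat -> R -> C, forall x, Om x ->
        series (fun j => vecpart x ^+ j * f j (scpart x)) @ \oo --> F x &
      forall t, Om (realpoint t) -> F (realpoint t) = f0 t].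

(* GCK[f0] on an axially symmetric slice domain Om; only the values on Om are
   meaningful. Real-analyticity of f0 is implied by the existence of an
   extension, which is then unique on Om; the zero function stands for the
   missing extension when there is none. *)
Definition gck (Om : set E) (f0 : R -> C) : E -> C :=
  xget (fun=> 0) [set F | is_gck Om f0 F].

Definition gck_prod (Om : set E) F G : E -> C :=
  gck Om (fun t => F (realpoint t) * G (realpoint t)).

(** * Elementary functions of a paravector *)

Definition cl_sinh (a : C) : C :=
  limn (series (fun k => (k.*2.+1`!%:R)^-1 *: a ^+ k.*2.+1)).
Definition cl_cosh (a : C) : C :=
  limn (series (fun k => (k.*2`!%:R)^-1 *: a ^+ k.*2)).
Definition cl_sin (a : C) : C :=
  limn (series (fun k => ((-1) ^+ k / k.*2.+1`!%:R) *: a ^+ k.*2.+1)).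
Definition cl_cos (a : C) : C :=
  limn (series (fun k => ((-1) ^+ k / k.*2`!%:R) *: a ^+ k.*2)).

(* The power (n - 1) / 2 is meant for odd n. *)
Definition fueter_sce (F : E -> C) : E -> C :=
  iter (n.-1)./2 laplacian F.

Definition SINH : E -> C := fueter_sce (cl_sinh \o paravector).
Definition COSH : E -> C := fueter_sce (cl_cosh \o paravector).
Definition SIN : E -> C := fueter_sce (cl_sin \o paravector).
Definition COS : E -> C := fueter_sce (cl_cos \o paravector).

End Clifford_analysis.

Arguments SINH {R n} x.
Arguments COSH {R n} x.
Arguments SIN {R n} x.
Arguments COS {R n} x.

(** * The constants *)

Definition Gamma (R : realType) (s : R) : R :=
  \int[lebesgue_measure]_(t in `]0, +oo[) (t `^ (s - 1) * expR (- t)).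

Definition gamma_const (R : realType) (n : nat) : R :=
  (-1) ^+ (n.-1)./2 * 2 ^+ n.-1 / (n.-1)`!%:R * Gamma (n.+1%:R / 2) ^+ 2.

(* Main.v *)
(** The generalized CK-product only sees the restrictions to the real axis.
Writing [F = P (t, |xv| ^ 2) + xv * Q (t, |xv| ^ 2)] with [t] the scalar part and
[xv] the vector part of [x], the Laplacian acts on the Taylor coefficients of
[P] and [Q] in [|xv| ^ 2]; starting from the addition theorem for [cos (t + xv)],
the [m]-th iterate restricts to [gamma * cos] on the axis, up to sign ([n = 2 m + 1]).
Since [cos ^ 2 = (1 + cos (2 t)) / 2] and [sin ^ 2 = (1 - cos (2 t)) / 2], and the
extension of [cos (2 t)] exists (a Bessel-type series), the identity follows from
the linearity and uniqueness of the extension.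

Uniqueness is the delicate point, because the coefficient functions [f_j] of an
extension are not assumed to be regular. Monogenicity makes the coefficients of
[P] and [Q] satisfy, in integrated form, a recurrence which propagates the
vanishing of the first one. On an interval where all coefficients share a common
bound this propagation is a mean value argument. By a Baire category argument on
the complement of the open set where everything vanishes, that set is the whole line.
The hyperbolic case is the same computation with the sign [e = -1] instead of
[e = 1] in [ta' = - e * si], [si' = ta]. *)

Require Import Defs.
From HB Require Import structures.
From mathcomp Require Import all_boot all_order all_algebra.
From mathcomp Require Import all_classical all_reals all_analysis.
From mathcomp Require Import ring lra.
Import Order.TTheory GRing.Theory Num.Theory.
Import numFieldNormedType.Exports.
Local Open Scope classical_set_scope.
Local Open Scope ring_scope.

Set Implicit Arguments.
Unset Strict Implicit.
Unset Printing Implicit Defensive.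

(** For the axial parts [P] and [Q] of an extension, as functions of [t] and [s = |xv| ^ 2],
    monogenicity reads [P_t = 2 s Q_s + n Q] and [Q_t = - 2 P_s]. On coefficients this is
    [p_k' = (2 k + n) q_k] and [q_k' = - 2 (k + 1) p_(k+1)], so differentiable coefficients with
    [p_0 = 0] would vanish one after the other. What is available is weaker: for each fixed [s > 0]
    the sums, not the coefficients, are differentiable in [t], and the bounds on the coefficients
    depend on [t]. A locally uniform bound therefore has to be produced before any limit in [s] can
    be exchanged with a derivative in [t]; this is the purpose of the Baire argument. The same
    system is solved by separation of variables: if [ta' = mu * si] and [si' = la * ta], the ansatz
    [ta t * c (s) + si t * q (s) * xv] leaves a recursion for the coefficients of [c] and [q]. The
    elementary functions, their Laplacians and the extension of the double-angle function all have
    this shape. *)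

(** * Real power series with infinite radius of convergence *)

Section PowerSeries.
Variable R : realType.
Implicit Types (c d : nat -> R) (x r M : R).

(* Locked: unifying two distinct sums would otherwise unfold limits. *)
Definition psum c x : R := locked (fun c x => limn (pseries c x)) c x.

Lemma psumE c x : psum c x = limn (pseries c x).
Proof. by rewrite /psum -lock. Qed.

(** Infinite radius of convergence, expressed by bounded terms; [entire_cvg] and [cvg_entire]
    translate to convergence. Domination is then immediate, and with [1 <= r] a shift of the index
    costs no constant. *)
Definition entire c : Prop :=
  forall r, 1 <= r -> exists M, forall k, `|c k| * r ^+ k <= M.

Lemma cvg_pseries_of_bound c r M x : 0 < r -> `|x| < r ->
  (forall k, `|c k| * r ^+ k <= M) -> cvgn (pseries c x).
Proof.
move=> r0 xr cM; apply: normed_cvg.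
have M0 : 0 <= M by apply: le_trans (cM 0%N); rewrite expr0 mulr1.
apply: (@series_le_cvg _ _ (geometric M (`|x| / r))) => [n|n|n|].
- exact: normr_ge0.
- by rewrite /= mulr_ge0 // exprn_ge0 // divr_ge0 // ltW.
- rewrite /= normrM normrX expr_div_n mulrA ler_pdivlMr ?exprn_gt0 //.
  by rewrite mulrAC ler_wpM2r ?exprn_ge0.
- apply: is_cvg_geometric_series.
  by rewrite normrM normr_id normfV (gtr0_norm r0) ltr_pdivrMr // mul1r.
Qed.

Lemma entire_cvg c x : entire c -> cvgn (pseries c x).
Proof.
have r1 : 1 <= `|x| + 1 by rewrite lerDr.
move=> /(_ _ r1)[M cM]; apply: cvg_pseries_of_bound cM.
  exact: lt_le_trans r1.
by rewrite ltrDl.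
Qed.

Lemma cvg_entire c : (forall x, 0 < x -> cvgn (pseries c x)) -> entire c.
Proof.
move=> cc r r1; have r0 : 0 < r by exact: lt_le_trans r1.
have [M [_ Mc]] := cvg_series_bounded (cc _ r0).
exists (M + 1) => k; have /= := Mc (M + 1) _ k I.
by rewrite normrM normrX (gtr0_norm r0) ltrDl; apply.
Qed.

Lemma entire_bounded c : entire c -> exists M, forall k, `|c k| <= M.
Proof.
by move=> /(_ _ (lexx 1))[M cM]; exists M => k; rewrite -[leLHS]mulr1 -(expr1n _ k).
Qed.

Lemma entire_le c d : (forall k, `|c k| <= `|d k|) -> entire d -> entire c.
Proof.
move=> cd ed r r1; have [M dM] := ed _ r1; exists M => k.
by apply: le_trans (dM k); rewrite ler_wpM2r // exprn_ge0 // (le_trans _ r1).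
Qed.

Lemma entireD c d : entire c -> entire d -> entire (fun k => c k + d k).
Proof.
move=> ec ed r r1; have [M cM] := ec _ r1; have [N dN] := ed _ r1.
exists (M + N) => k; apply: le_trans (lerD (cM k) (dN k)).
by rewrite -mulrDl ler_wpM2r ?ler_normD // exprn_ge0 // (le_trans _ r1).
Qed.

Lemma entireZ a c : entire c -> entire (fun k => a * c k).
Proof.
move=> ec r r1; have [M cM] := ec _ r1; exists (`|a| * M) => k.
by rewrite normrM -mulrA ler_wpM2l.
Qed.

Lemma ler_nat_expn2 k : k%:R <= 2 ^+ k :> R.
Proof. by rewrite -natrX ler_nat ltnW // ltn_expl. Qed.

(** Doubling the radius absorbs the factor [k], as [k <= 2 ^ k]. *)
Lemma entire_mulnat c : entire c -> entire (fun k => k%:R * c k).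
Proof.
move=> ec r r1; have r0 : 0 <= r by exact: le_trans r1.
have [|M cM] := ec (2 * r); first by lra.
exists M => k; apply: le_trans (cM k).
rewrite normrM exprMn mulrA ler_wpM2r ?exprn_ge0 // mulrC ler_wpM2l //.
by rewrite normr_nat ler_nat_expn2.
Qed.

Lemma entire_shift c : entire c -> entire (fun k => c k.+1).
Proof.
move=> ec r r1; have [M cM] := ec _ r1; exists M => k.
have r0 : 0 <= r by exact: le_trans r1.
apply: le_trans (cM k.+1); rewrite exprS ler_wpM2l // ler_peMl ?exprn_ge0 //.
Qed.

Lemma entire_diffs c : entire c -> entire (pseries_diffs c).
Proof. by move=> ec; exact/(@entire_shift (fun k => k%:R * c k))/entire_mulnat. Qed.

Lemma entire_inv_fact a : entire (fun k => a ^+ k / k`!%:R).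
Proof.
apply: cvg_entire => x x0; rewrite (_ : pseries _ _ = series (exp_coeff (a * x))).
  exact: is_cvg_series_exp_coeff.
congr series; apply/funext => k.
by rewrite /exp_coeff /= exprMn mulrAC.
Qed.

Lemma is_derive_psum c x : entire c ->
  is_derive x 1 (psum c) (psum (pseries_diffs c) x).
Proof.
move=> ec; rewrite psumE (_ : psum c = fun x => limn (pseries c x)); last first.
  by apply/funext => y; rewrite psumE.
apply: (@pseries_snd_diffs _ _ (`|x| + 1)).
- exact: entire_cvg.
- exact/entire_cvg/entire_diffs.
- exact/entire_cvg/entire_diffs/entire_diffs.
- by rewrite [ltRHS]ger0_norm ?ltrDl ?addr_ge0.
Qed.

Lemma continuous_psum c : entire c -> continuous (psum c).
Proof.
move=> ec x; apply/differentiable_continuous/derivable1_diffP.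
by have := is_derive_psum x ec => -[].
Qed.

Lemma psum_cvg c x : entire c -> pseries c x @ \oo --> psum c x.
Proof. by move=> ec; rewrite psumE; exact: entire_cvg. Qed.

(** Convergence is asked only at the point [x], so that the lemma also serves sequences that are
    merely bounded. *)
Lemma psum_shift_cvg c x : cvgn (pseries (fun k => c k.+1) x) ->
  cvgn (pseries c x) /\
  psum c x = c 0%N + x * psum (fun k => c k.+1) x.
Proof.
move=> cs.
have E : pseries c x @ \oo --> c 0%N + x * psum (fun k => c k.+1) x.
  rewrite -(cvg_shiftS (pseries c x)).
  have -> : (fun n => pseries c x n.+1) =
      (fun n => c 0%N + x * pseries (fun k => c k.+1) x n).
    apply/funext => n; rewrite /pseries /series /= big_nat_recl // expr0 mulr1.
    congr (_ + _); rewrite mulr_sumr; apply: eq_bigr => i _.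
    by rewrite exprS mulrCA.
  by apply: cvgD; [exact: cvg_cst | apply: cvgMr; rewrite psumE].
by split; [exact: cvgP E | rewrite psumE; exact: cvg_lim E].
Qed.

Lemma psum_shift c x : entire c ->
  psum c x = c 0%N + x * psum (fun k => c k.+1) x.
Proof. by move=> ec; apply: (@psum_shift_cvg c x _).2; exact/entire_cvg/entire_shift. Qed.

Lemma psum0 c : entire c -> psum c 0 = c 0%N.
Proof. by move=> ec; rewrite psum_shift // mul0r addr0. Qed.

Lemma psumD c d x : entire c -> entire d ->
  psum (fun k => c k + d k) x = psum c x + psum d x.
Proof.
move=> ec ed; rewrite psumE; apply: cvg_lim => //.
rewrite (_ : pseries _ _ = fun n => pseries c x n + pseries d x n).
  by apply: cvgD; exact: psum_cvg.
apply/funext => n; rewrite /pseries /series /= -big_split; apply: eq_bigr => i _.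
by rewrite mulrDl.
Qed.

Lemma psumZ a c x : entire c -> psum (fun k => a * c k) x = a * psum c x.
Proof.
move=> ec; rewrite psumE; apply: cvg_lim => //.
rewrite (_ : pseries _ _ = fun n => a * pseries c x n).
  by apply: cvgMr; exact: psum_cvg.
apply/funext => n; rewrite /pseries /series /= mulr_sumr; apply: eq_bigr => i _.
by rewrite mulrA.
Qed.

Lemma psum_eq0 c x : (forall k, c k = 0) -> psum c x = 0.
Proof.
move=> c0; rewrite psumE; apply: cvg_lim => //.
rewrite (_ : pseries c x = fun=> 0); first exact: cvg_cst.
by apply/funext => N; rewrite /pseries /series /= big1 // => k _; rewrite c0 mul0r.
Qed.

Lemma psum_mulnat c x : entire c ->
  psum (fun k => k%:R * c k) x = x * psum (pseries_diffs c) x.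
Proof. by move=> ec; rewrite psum_shift ?mul0r ?add0r //; exact: entire_mulnat. Qed.

Lemma entire_affine (m : R) c : entire c -> entire (fun k => (2 * k%:R + m) * c k).
Proof.
move=> ec; have := entireD (entireZ 2 (entire_mulnat ec)) (entireZ m ec).
by congr entire; apply/funext => k; ring.
Qed.

Lemma psum_affine (m : R) c x : entire c ->
  psum (fun k => (2 * k%:R + m) * c k) x =
  2 * x * psum (pseries_diffs c) x + m * psum c x.
Proof.
move=> ec; have e1 := entireZ 2 (entire_mulnat ec); have e2 := entireZ m ec.
rewrite -mulrA -psum_mulnat // -!psumZ -?psumD //; last exact: entire_mulnat.
by congr psum; apply/funext => k; ring.
Qed.

(** For [|x| <= 1/2] the geometric majorant [M / (1 - |x|)] is at most [2 * M]; this is the origin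
    of the restriction [s <= 2^-1] in what follows. *)
Lemma psum_bound c M x : (forall k, `|c k| <= M) -> `|x| <= 2^-1 ->
  cvgn (pseries c x) /\ `|psum c x| <= 2 * M.
Proof.
move=> cM x2.
have x1 : `|x| < 1 by apply: le_lt_trans x2 _; rewrite invf_lt1 // ltr1n.
have M0 : 0 <= M := le_trans (normr_ge0 _) (cM 0%N).
have cc : cvgn (pseries c x).
  by apply: (@cvg_pseries_of_bound _ 1 M) => // k; rewrite expr1n mulr1.
split=> //; rewrite psumE.
have cg := @cvg_geometric_series R M `|x|.
have := lim_series_norm; move/(_ R R _ _) => /=.
have cn : cvgn [normed pseries c x].
  apply: (@series_le_cvg _ _ (geometric M `|x|)) => [n|n|n|].
  - exact: normr_ge0.
  - by rewrite /= mulr_ge0 // exprn_ge0.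
  - by rewrite /= normrM normrX ler_wpM2r ?exprn_ge0.
  - by apply/cvgP/cg; rewrite normr_id.
move=> /(_ _ cn) h; apply: le_trans h _.
apply: (@le_trans _ _ (M / (1 - `|x|))); last first.
  rewrite mulrC ler_wpM2r // -[leRHS]invrK lef_pV2 ?posrE ?invr_gt0 // ?subr_gt0 //.
  lra.
rewrite -(cvg_lim _ (cg _)) ?normr_id //.
apply: lim_series_le => //.
- by apply/cvgP/cg; rewrite normr_id.
- by move=> n /=; rewrite normrM normrX ler_wpM2r ?exprn_ge0.
Qed.

Lemma psum_bound_shift c M x : (forall k, `|c k| <= M) -> `|x| <= 2^-1 ->
  psum c x = c 0%N + x * psum (fun k => c k.+1) x /\
  `|psum c x - c 0%N| <= 2 * M * `|x|.
Proof.
move=> cM x2; have [cs bs] := @psum_bound (fun k => c k.+1) M x (fun k => cM _) x2.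
have -> := (psum_shift_cvg cs).2; split=> //.
by rewrite addrAC subrr add0r normrM mulrC ler_wpM2r.
Qed.

End PowerSeries.

(** * Coefficients of power series depending on a real parameter *)

Section ParametricPowerSeries.
Variable R : realType.
Implicit Types (c d : R -> nat -> R) (s t l r M : R).

(** Under a common bound [M] a sum differs from its leading coefficient by at most [2 * M * s],
    uniformly in [t]; hence convergence of the sums at one small [s] controls the leading
    coefficient. *)
Lemma coef0_cvg (F : set_system R) (FF : Filter F) c (c0 : nat -> R) M :
  (\forall t \near F, forall k, `|c t k| <= M) -> (forall k, `|c0 k| <= M) ->
  (forall s, 0 < s -> s <= 2^-1 -> psum (c t) s @[t --> F] --> psum c0 s) ->
  c t 0%N @[t --> F] --> c0 0%N.
Proof.
move=> cM c0M cs.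
have M0 : 0 <= M := le_trans (normr_ge0 _) (c0M 0%N).
apply/cvgrPdist_le => e e0.
(* This [s] makes both truncation errors at most [e / 4], which leaves [e / 2] for the sums; [M + 1]
   keeps the denominator positive. *)
pose s := Num.min 2^-1 (e / (8 * (M + 1))).
have s0 : 0 < s by rewrite lt_min invr_gt0 ltr0n /= divr_gt0 // mulr_gt0 //; lra.
have s2 : s <= 2^-1 by rewrite ge_min lexx.
have sn : `|s| <= 2^-1 by rewrite gtr0_norm.
have Ms : 2 * M * `|s| <= e / 4.
  rewrite gtr0_norm //; have : s * (8 * (M + 1)) <= e.
    by rewrite -ler_pdivlMr ?ge_min ?lexx ?orbT // mulr_gt0 //; lra.
  nra.
have e2 : 0 < e / 2 by lra.
have /cvgrPdist_le /(_ _ e2) csM := cs _ s0 s2.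
near=> t.
have cMt : forall k, `|c t k| <= M by near: t.
have csMt : `|psum c0 s - psum (c t) s| <= e / 2 by near: t.
have [_ h1] := psum_bound_shift cMt sn; have [_ h2] := psum_bound_shift c0M sn.
move: h1 h2 csMt; rewrite !ler_norml => /andP[? ?] /andP[? ?] /andP[? ?].
by apply/andP; split; lra.
Unshelve. all: by end_near. Qed.

Lemma psum_tail (c : nat -> R) M s : (forall k, `|c k| <= M) ->
  0 < s -> s <= 2^-1 ->
  psum (fun k => c k.+1) s = s^-1 * (psum c s - c 0%N).
Proof.
move=> cM s0 s2; have sn : `|s| <= 2^-1 by rewrite gtr0_norm.
rewrite (psum_bound_shift cM sn).1.
by rewrite addrAC subrr add0r mulrA mulVf ?mul1r ?gt_eqF.
Qed.

(** Once the leading coefficient converges, so does the sum of the tail, [s^-1] times the remainder,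
    and the next coefficient is leading there. *)
Lemma coef_cvg (F : set_system R) (FF : Filter F) c (c0 : nat -> R) M k :
  (\forall t \near F, forall k, `|c t k| <= M) -> (forall k, `|c0 k| <= M) ->
  (forall s, 0 < s -> s <= 2^-1 -> psum (c t) s @[t --> F] --> psum c0 s) ->
  c t k @[t --> F] --> c0 k.
Proof.
elim: k c c0 => [|k IH] c c0 cM c0M cs; first exact: coef0_cvg cM c0M cs.
apply: (IH (fun t k => c t k.+1) (fun k => c0 k.+1)) => //.
  by apply: filterS cM => t cM j; exact: cM.
move=> s s0 s2; rewrite (psum_tail c0M) //.
have h : (s^-1 * (psum (c t) s - c t 0%N)) @[t --> F]
    --> s^-1 * (psum c0 s - c0 0%N).
  by apply: cvgMr; apply: cvgB; [exact: cs | exact: coef0_cvg cM c0M cs].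
apply: cvg_trans h; apply: near_eq_cvg.
by apply: filterS cM => t cM; rewrite (psum_tail cM).
Qed.

(** At a limit point [t] some bound [N] holds, possibly larger than [M]. It suffices to show that
    the coefficients converge to [d t k] along the set, and then the bound [M] passes to the
    limit. *)
Lemma closed_coef_bound d M :
  (forall t, exists N, forall k, `|d t k| <= N) ->
  (forall s, 0 < s -> s <= 2^-1 -> continuous (fun t => psum (d t) s)) ->
  closed [set t | forall k, `|d t k| <= M].
Proof.
move=> db dc t clt /= k; have [N dN] := db t.
set A := [set t | _] in clt.
have PF : ProperFilter (within A (nbhs t)).
  by apply: within_nbhs_proper.
have h : d t' k @[t' --> within A (nbhs t)] --> d t k.
  apply: (@coef_cvg _ _ d (d t) (Num.max M N)).
  - apply: filterS (withinT A _) => t' At' j.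
    by rewrite le_max At'.
  - by move=> j; rewrite le_max dN orbT.
  - by move=> s s0 s2; apply: cvg_within_filter; exact: dc.
apply: (cvgr_to_le (cvg_norm h)).
by apply: filterS (withinT A _) => t'; apply.
Qed.

(** As [c t 0 = 0], the sum of [c t] is [O(s)], while its derivative in [t] is [d t 0 + O(s)], both
    uniformly in [t]. The mean value theorem on an interval of fixed length, with [s] small,
    excludes [d t 0 != 0]. *)
Lemma lead_zero l r M c d :
  (forall t, l < t < r -> forall k, `|c t k| <= M) ->
  (forall t, l < t < r -> forall k, `|d t k| <= M) ->
  (forall s t, 0 < s -> s <= 2^-1 -> l < t < r ->
     is_derive t 1 (fun t => psum (c t) s) (psum (d t) s)) ->
  (forall s t, 0 < s -> s <= 2^-1 -> l < t < r ->
     {for t, continuous (fun t => psum (d t) s)}) ->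
  (forall t, l < t < r -> c t 0%N = 0) ->
  forall t, l < t < r -> d t 0%N = 0.
Proof.
move=> cM dM cd dc c0 t0 lt0r; apply/eqP/negPn/negP => d0.
have M0 : 0 <= M := le_trans (normr_ge0 _) (cM _ lt0r 0%N).
have nlr t : l < t < r -> \forall t' \near t, l < t' < r.
  by move=> ltr; apply: (@near_in_itvoo _ l r); rewrite in_itv.
have h : d t 0%N @[t --> t0] --> d t0 0%N.
  apply: (@coef_cvg _ _ d (d t0) M) => [|//|s s0 s2].
    - by near=> t; apply: dM; near: t; exact: nlr.
    - by move=> k; exact: dM.
    - exact: dc.
have e0 : 0 < `|d t0 0%N| / 2 by rewrite divr_gt0 // normr_gt0.
have /cvgrPdist_le /(_ _ e0) hn := h.
have [e /= ep he] := filterI hn (nlr _ lt0r).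
have e2 : 0 < e / 2 by move: ep => /=; lra.
(* [D] is half of [|d t0 0|], so [|d t 0|] stays at least [D] on [[t0, t1]]. *)
pose L := e / 2; pose t1 := t0 + L; pose D := `|d t0 0%N| / 2.
have sub t : t0 <= t <= t1 -> `|d t0 0%N - d t 0%N| <= D /\ l < t < r.
  move=> /andP[a b]; apply: he; rewrite /ball /= distrC ger0_norm ?subr_ge0 //.
  by move: b; rewrite /t1 /L; lra.
have t01 : t0 < t1 by rewrite /t1 ltrDl.
(* The mean value theorem will give [(D - 2 * M * s) * L <= 4 * M * s]; this [s] is small enough to
   contradict it. *)
pose s := Num.min 2^-1 (D * L / (8 * (M + 1) * (1 + L))).
have P0 : 0 < 8 * (M + 1) * (1 + L) by rewrite !mulr_gt0 // ?ltr0n // /L; lra.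
have s0 : 0 < s by rewrite lt_min invr_gt0 ltr0n /= divr_gt0 // mulr_gt0.
have s2 : s <= 2^-1 by rewrite ge_min lexx.
have sn : `|s| <= 2^-1 by rewrite gtr0_norm.
have sP : s * (8 * (M + 1) * (1 + L)) <= D * L.
  by rewrite -ler_pdivlMr // ge_min lexx orbT.
have [||x xI] := @MVT _ (fun t => psum (c t) s) (fun t => psum (d t) s) _ _ t01.
- move=> x /[!in_itv] /= /andP[a b]; apply: cd => //.
  by apply: (sub x _).2; rewrite !ltW.
- apply: (@derivable_within_continuous _ _ _ `[t0, t1]) => x /[!in_itv] /= /sub[_ xlr].
  by have [] := cd s x s0 s2 xlr.
move: xI; rewrite in_itv /= => /andP[/ltW a /ltW b].
have [dx xlr] := sub x (introT andP (conj a b)).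
have [_ t1lr] := sub t1 (introT andP (conj (ltW t01) (lexx _))).
have bnd t : l < t < r -> `|psum (c t) s| <= 2 * M * s.
  move=> tlr; have := (psum_bound_shift (cM _ tlr) sn).2.
  by rewrite c0 // subr0 (gtr0_norm s0).
have b1 := bnd _ t1lr; have b0 := bnd _ lt0r.
have bx := (psum_bound_shift (dM _ xlr) sn).2; rewrite (gtr0_norm s0) in bx.
have -> : t1 - t0 = L by rewrite /t1 addrAC subrr add0r.
move=> /(congr1 (fun z => `|z|)); rewrite normrM (gtr0_norm e2) => E.
have h1 : D - 2 * M * s <= `|psum (d x) s|.
  have h1 := ler_normD (d t0 0%N - d x 0%N) (d x 0%N).
  have h2 := ler_normD (psum (d x) s) (d x 0%N - psum (d x) s).
  rewrite subrK in h1; rewrite [psum _ _ + _]addrC subrK in h2.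
  rewrite distrC in bx; rewrite /D in dx *; lra.
have h2 : `|psum (d x) s| * L <= 4 * M * s.
  by rewrite -E; apply: le_trans (ler_normB _ _) _; lra.
have h3 : (D - 2 * M * s) * L <= 4 * M * s.
  by apply: le_trans h2; rewrite ler_wpM2r // ltW.
have h4 : 0 < D * L by rewrite mulr_gt0.
have h5 : 0 <= M * s by rewrite mulr_ge0 // ltW.
have h6 : 0 <= M * s * L by rewrite mulr_ge0 // ltW.
have h7 : 0 <= s * L by rewrite mulr_ge0 // ltW.
by move: s0; lra.
Unshelve. all: by end_near. Qed.

(** From [p_0 = 0], [lead_zero] gives [q_0 = 0] and then [p_1 = 0]. The sequences without their
    leading terms satisfy the same kind of system with [al] and [be] shifted, so the induction
    generalises over all four. *)
Lemma all_zero l r M (p q : R -> nat -> R) (al be : nat -> R) :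
  (forall k, al k != 0) -> (forall k, be k != 0) ->
  (forall t, l < t < r -> forall k, `|p t k| <= M) ->
  (forall t, l < t < r -> forall k, `|q t k| <= M) ->
  (forall t, l < t < r -> forall k, `|al k * q t k| <= M) ->
  (forall t, l < t < r -> forall k, `|be k * p t k.+1| <= M) ->
  (forall s t, 0 < s -> s <= 2^-1 -> l < t < r ->
     is_derive t 1 (fun t => psum (p t) s) (psum (fun k => al k * q t k) s)) ->
  (forall s t, 0 < s -> s <= 2^-1 -> l < t < r ->
     is_derive t 1 (fun t => psum (q t) s) (psum (fun k => be k * p t k.+1) s)) ->
  (forall s t, 0 < s -> s <= 2^-1 -> l < t < r ->
     {for t, continuous (fun t => psum (fun k => al k * q t k) s)}) ->
  (forall s t, 0 < s -> s <= 2^-1 -> l < t < r ->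
     {for t, continuous (fun t => psum (fun k => be k * p t k.+1) s)}) ->
  (forall t, l < t < r -> p t 0%N = 0) ->
  forall k t, l < t < r -> p t k = 0 /\ q t k = 0.
Proof.
move=> al0 be0 pM qM aM bM dp dq ca cb p0 k.
have nlr t : l < t < r -> \forall t' \near t, l < t' < r.
  by move=> ltr; have := @near_in_itvoo _ l r t; rewrite in_itv; apply.
elim: k => [|k IH] in p q al be al0 be0 pM qM aM bM dp dq ca cb p0 *.
all: have q0 t : l < t < r -> q t 0%N = 0.
1,3: move=> tlr; have /eqP := lead_zero pM aM dp ca p0 tlr.
1,2: by rewrite mulf_eq0 (negPf (al0 _)) /= => /eqP.
  by move=> t tlr; rewrite p0 ?q0.
have p1 t : l < t < r -> p t 1%N = 0.
  move=> tlr; have /eqP := lead_zero qM bM dq cb q0 tlr.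
  by rewrite mulf_eq0 (negPf (be0 _)) /= => /eqP.
(* With vanishing leading coefficients on the interval, the tail sums are [s^-1] times the full sums
   near each [t], so the derivative and the continuity carry over. *)
have tail (c : R -> nat -> R) (d : R -> nat -> R) :
    (forall t, l < t < r -> forall k, `|c t k| <= M) ->
    (forall t, l < t < r -> forall k, `|d t k| <= M) ->
    (forall t, l < t < r -> c t 0%N = 0) -> (forall t, l < t < r -> d t 0%N = 0) ->
    (forall s t, 0 < s -> s <= 2^-1 -> l < t < r ->
      is_derive t 1 (fun t => psum (c t) s) (psum (d t) s)) ->
    (forall s t, 0 < s -> s <= 2^-1 -> l < t < r ->
      {for t, continuous (fun t => psum (d t) s)}) ->
    (forall s t, 0 < s -> s <= 2^-1 -> l < t < r ->
      is_derive t 1 (fun t => psum (fun k => c t k.+1) s) (psum (fun k => d t k.+1) s)) /\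
    (forall s t, 0 < s -> s <= 2^-1 -> l < t < r ->
      {for t, continuous (fun t => psum (fun k => d t k.+1) s)}).
  move=> cM dM c0 d0 cd dc; split=> s t s0 s2 tlr.
    have h : is_derive t 1 (fun t => s^-1 * psum (c t) s) (s^-1 * psum (d t) s).
      exact: is_deriveZ (cd s t s0 s2 tlr).
    rewrite (psum_tail (dM _ tlr)) // d0 // subr0.
    apply: near_eq_is_derive h; near=> t'.
    have t'lr : l < t' < r by near: t'; exact: nlr.
    by rewrite (psum_tail (cM _ t'lr)) // c0 // subr0.
  have h : {for t, continuous (fun t => s^-1 * psum (d t) s)}.
    by apply: cvgMr; exact: dc.
  rewrite /prop_for /continuous_at (psum_tail (dM _ tlr)) // d0 // subr0.
  apply: cvg_trans h; apply: near_eq_cvg; near=> t'.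
  have t'lr : l < t' < r by near: t'; exact: nlr.
  by rewrite (psum_tail (dM _ t'lr)) // d0 // subr0.
have [|dp' ca'] := tail p _ pM aM p0 _ dp ca; first by move=> t tlr; rewrite q0 ?mulr0.
have [|dq' cb'] := tail q _ qM bM q0 _ dq cb; first by move=> t tlr; rewrite p1 ?mulr0.
apply: (IH (fun t k => p t k.+1) (fun t k => q t k.+1)
  (fun k => al k.+1) (fun k => be k.+1)) => // t tlr j; auto.
Unshelve. all: by end_near. Qed.

End ParametricPowerSeries.

(** * A Baire category argument on the line *)

Section NestedIntervals.
Variable R : realType.
Implicit Types (K : set R) (F : nat -> set R) (l r t : R).

(* Baire category by nested intervals; as the F_M cover the whole line, the limit
   point need not lie in K, so K need not be closed. *)
Lemma baire_interval K F : (forall M, closed (F M)) ->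
  (forall t, exists M, F M t) -> K !=set0 ->
  exists l r M, (exists2 t, K t & l < t < r) /\
    (forall t, K t -> l < t < r -> F M t).
Proof.
move=> Fcl Fcov [t0 Kt0]; apply: contrapT => H.
(* An interval is good when it meets [K]. If the conclusion fails, every good interval contains, for
   each [M], a smaller good one whose closure misses [F M]. *)
pose good (I : R * R) := exists2 t, K t & I.1 < t < I.2.
have step M (I : R * R) : good I -> exists J : R * R,
    [/\ good J, I.1 < J.1, J.2 < I.2 & forall t, J.1 <= t <= J.2 -> ~ F M t].
  move=> gI; have [t [Kt tI nFt]] : exists t, [/\ K t, I.1 < t < I.2 & ~ F M t].
    apply: contrapT => nt; apply: H; exists I.1, I.2, M; split=> // t Kt tI.
    by apply: contrapT => nF; apply: nt; exists t.
  have /= : nbhs t (~` F M) by apply: open_nbhs_nbhs; split => //; exact/closed_openC.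
  move=> /nbhs_ballP[e /= e0 he].
  move: tI => /andP[tl tr].
  pose d := Num.min (e / 2) (Num.min ((t - I.1) / 2) ((I.2 - t) / 2)).
  have d0 : 0 < d by rewrite !lt_min; apply/and3P; split; lra.
  have de : d <= e / 2 by rewrite ge_min lexx.
  have dl : d <= (t - I.1) / 2 by rewrite !ge_min lexx orbT.
  have dr : d <= (I.2 - t) / 2 by rewrite !ge_min lexx !orbT.
  exists (t - d, t + d); split => /=.
  - by exists t => //=; apply/andP; split; lra.
  - lra.
  - lra.
  - move=> u ud; apply: he; rewrite /ball /= ltr_norml.
    by move: ud => /andP[? ?]; apply/andP; split; lra.
have [f fP] : exists f : nat -> R * R -> R * R, forall M I, good I ->
    [/\ good (f M I), I.1 < (f M I).1, (f M I).2 < I.2 &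
     forall t, (f M I).1 <= t <= (f M I).2 -> ~ F M t].
  have /choice[f fP] : forall MI : nat * (R * R), exists J : R * R, good MI.2 ->
      [/\ good J, MI.2.1 < J.1, J.2 < MI.2.2 &
       forall t, J.1 <= t <= J.2 -> ~ F MI.1 t].
    move=> [M I]; have [/(step M)[J JP]|nI] := pselect (good I); first by exists J.
    by exists I.
  by exists (fun M I => f (M, I)) => M I; exact: (fP (M, I)).
pose I := fix I n := if n is m.+1 then f m (I m) else (t0 - 1, t0 + 1).
have gI n : good (I n).
  elim: n => [|n IH] /=; first by exists t0 => //=; apply/andP; split; lra.
  by have [] := fP n _ IH.
have lt12 n : (I n).1 < (I n).2.
  by have [t _ /andP[a b]] := gI n; exact: lt_trans b.
have IS n : (I n).1 < (I n.+1).1 /\ (I n.+1).2 < (I n).2.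
  by have [_ a b _] := fP n _ (gI n).
have mono n m : (I n).1 <= (I (n + m)%N).1 /\ (I (n + m)%N).2 <= (I n).2.
  elim: m => [|m [a b]]; first by rewrite addn0.
  rewrite addnS; have [c d] := IS (n + m)%N.
  by rewrite (le_trans a (ltW c)) (le_trans (ltW d) b).
have le12 n m : (I n).1 <= (I m).2.
  have [a _] := mono n m; have [_ b] := mono m n; rewrite addnC in b.
  exact: le_trans (le_trans a (ltW (lt12 _))) b.
pose A := range (fun n => (I n).1).
have A0 : A !=set0 by exists (I 0%N).1; exists 0%N.
have ubA m : ubound A (I m).2 by move=> _ [n _ <-]; exact: le12.
have [M FM] := Fcov (sup A).
(* The supremum of the left endpoints lies in all the closed intervals, in particular in the one
   with index [M.+1], which was built to miss [F M]. *)
have [_ _ _ /(_ (sup A))] := fP M _ (gI M); apply => //.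
apply/andP; split; last exact: (@ge_sup _ _ _ A0 (ubA M.+1)).
apply: ub_le_sup; last by exists M.+1.
by exists (I 0%N).2; exact: ubA.
Qed.

End NestedIntervals.

(** * Vanishing of the solutions of the coefficient system *)

Section Uniqueness.
Variable R : realType.

(** The closed sets [FM M] bound the coefficients of the two derivatives. Since [|al k|] and
    [|be k|] are at least 1 and [p t 0 = 0], the same number bounds [p] and [q]. *)
Lemma pseries_system_zero (p q : R -> nat -> R) (al be : nat -> R) :
  (forall k, 1 <= `|al k|) -> (forall k, 1 <= `|be k|) ->
  (forall t, entire (fun k => al k * q t k)) ->
  (forall t, entire (fun k => be k * p t k.+1)) ->
  (forall s t : R, 0 < s ->
     is_derive t 1 (fun t => psum (p t) s) (psum (fun k => al k * q t k) s)) ->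
  (forall s t : R, 0 < s ->
     is_derive t 1 (fun t => psum (q t) s) (psum (fun k => be k * p t k.+1) s)) ->
  (forall s : R, 0 < s -> continuous (fun t => psum (fun k => al k * q t k) s)) ->
  (forall s : R, 0 < s -> continuous (fun t => psum (fun k => be k * p t k.+1) s)) ->
  (forall t, p t 0%N = 0) ->
  forall t k, p t k = 0 /\ q t k = 0.
Proof.
move=> al1 be1 eq ep dp dq ca cb p0.
pose a t k := al k * q t k; pose b t k := be k * p t k.+1.
pose FM (M : nat) := [set t | forall k, `|a t k| <= M%:R] `&`
                     [set t | forall k, `|b t k| <= M%:R].
have FMcl M : closed (FM M).
  by apply: closedI; apply: closed_coef_bound => [t|s s0 _];
    [exact/entire_bounded/eq | exact: ca | exact/entire_bounded/ep | exact: cb].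
have FMcov t : exists M, FM M t.
  have [A aA] := entire_bounded (eq t); have [B bB] := entire_bounded (ep t).
  exists (Num.bound (`|A| + `|B|)).
  have Mb : `|A| + `|B| <= (Num.bound (`|A| + `|B|))%:R.
    by apply/ltW/archi_boundP; rewrite addr_ge0.
  split=> k /=; apply: le_trans Mb.
    by apply: le_trans (aA k) (le_trans (ler_norm _) _); rewrite lerDl.
  by apply: le_trans (bB k) (le_trans (ler_norm _) _); rewrite lerDr.
pose Z : set R := [set t | forall k, p t k = 0 /\ q t k = 0].
pose K : set R := [set t | ~ nbhs t Z].
suff K0 : ~ (K !=set0).
  move=> t; apply: (@nbhs_singleton _ t Z).
  by apply: contrapT => nZ; apply: K0; exists t.
move=> /(baire_interval FMcl FMcov)[l [r [M [[t1 Kt1 t1lr] KM]]]].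
(* Points of [K] in the interval are covered by Baire; at the other points all coefficients are zero
   and any bound holds. So the bound is uniform, [all_zero] applies, and [t1] turns out to be
   interior to [Z] although it lies in [K]. *)
have lrF t : l < t < r -> FM M t.
  move=> tlr; have [/KM|] := pselect (K t); first exact.
  move=> /contrapT /nbhs_singleton Zt.
  by split=> k /=; rewrite /a /b ?(Zt _).1 ?(Zt _).2 mulr0 normr0.
have M0 : 0 <= M%:R :> R by [].
have lec (c x : R) : 1 <= `|c| -> `|c * x| <= M%:R -> `|x| <= M%:R.
  move=> c1; apply: le_trans; rewrite normrM ler_peMl //.
have al0 k : al k != 0 by rewrite -normr_gt0 (lt_le_trans ltr01).
have be0 k : be k != 0 by rewrite -normr_gt0 (lt_le_trans ltr01).
apply: Kt1; have nlr : \forall t \near t1, l < t < r.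
  by have := @near_in_itvoo _ l r t1; rewrite in_itv; apply.
apply: filterS nlr => t tlr i; move: t tlr.
apply: (@all_zero _ l r M%:R p q al be) => //.
- move=> t /lrF[_ bt] [|k]; first by rewrite p0 normr0.
  exact: lec (be1 k) (bt k).
- by move=> t /lrF[at_ _] k; exact: lec (al1 k) (at_ k).
- by move=> t /lrF[at_ _] k; exact: at_.
- by move=> t /lrF[_ bt] k; exact: bt.
- by move=> s t s0 _ _; exact: dp.
- by move=> s t s0 _ _; exact: dq.
- by move=> s t s0 _ _; exact: ca.
- by move=> s t s0 _ _; exact: cb.
Qed.

End Uniqueness.

(** * Directional derivatives and continuity *)

Section DirectionalDerivatives.
Variable R : realType.

Lemma is_deriveP (V W : normedModType R) (f : V -> W) (x v : V) (df : W) :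
  is_derive x v f df <->
  (fun h => h^-1 *: (f (h *: v + x) - f x)) @ (0 : R)^' --> df.
Proof.
split=> [[dfx <-]|cf]; first exact: dfx.
apply: DeriveDef; first by apply/cvg_ex; exists df.
exact: cvg_lim cf.
Qed.

Variable V : normedModType R.

Lemma is_derive_line (W : normedModType R) (f : V -> W) (x v : V) (df : W) :
  is_derive x v f df <-> is_derive (0 : R) 1 (fun h => f (h *: v + x)) df.
Proof.
by split=> /is_deriveP c; apply/is_deriveP; apply: cvg_trans c;
  apply: near_eq_cvg; apply: filterE => h; rewrite /= addr0 scale0r add0r [_%:A]mulr1.
Qed.

(** Agreement on one line is enough. This permits freezing, in a vector direction, coefficients that
    depend on the scalar part. *)
Lemma eq_is_derive_line (W : normedModType R) (f g : V -> W) (x v : V) (df : W) :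
  (forall h : R, f (h *: v + x) = g (h *: v + x)) ->
  is_derive x v f df -> is_derive x v g df.
Proof.
by move=> fg; rewrite !is_derive_line (_ : (fun h => f _) = fun h => g (h *: v + x)) //;
  apply/funext.
Qed.

Lemma is_derive_linear (U W : normedModType R) (L : U -> W) (f : V -> U)
    (x v : V) (df : U) : linear L -> continuous L ->
  is_derive x v f df -> is_derive x v (L \o f) (L df).
Proof.
move=> Ll Lc /is_deriveP fx; apply/is_deriveP.
rewrite -(@eq_cvg _ _ _ (fun h => L (h^-1 *: (f (h *: v + x) - f x)))).
  exact: (continuous_cvg _ (Lc df)).
move=> h /=; have L0 : L 0 = 0.
  by apply: (addrI (L 0)); rewrite -[X in X + _ = _]scale1r -Ll scale1r !addr0.
have LB u w : L (u - w) = L u - L w.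
  by rewrite addrC -scaleN1r Ll scaleN1r addrC.
by rewrite -[X in L X]addr0 Ll L0 addr0 LB.
Qed.

Lemma is_derive_scalel (W : normedModType R) (f : V -> R) (w : W) (x v : V) (df : R) :
  is_derive x v f df -> is_derive x v (fun y => f y *: w) (df *: w).
Proof.
move=> /is_deriveP fx; apply/is_deriveP.
rewrite -(@eq_cvg _ _ _ (fun h => (h^-1 *: (f (h *: v + x) - f x)) *: w)).
  exact: cvgZr_tmp.
by move=> h /=; rewrite -scalerBl scalerA.
Qed.

Lemma is_derive_chain (p : R -> R) (f : V -> R) (x v : V) (dp df : R) :
  is_derive (f x) 1 p dp -> is_derive x v f df ->
  is_derive x v (fun y => p (f y)) (dp * df).
Proof.
move=> px /is_derive_line fx; apply/is_derive_line.
by apply: is_derive1_comp; rewrite scale0r add0r.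
Qed.

Lemma is_derive_mul (f g : V -> R) (x v : V) (df dg : R) :
  is_derive x v f df -> is_derive x v g dg ->
  is_derive x v (fun y => f y * g y) (df * g x + f x * dg).
Proof.
move=> fx gx; have := is_deriveM fx gx.
by rewrite /GRing.scale /= [g x * df]mulrC addrC.
Qed.

Lemma is_derive_bigsum (W : normedModType R) (I : finType) (F : I -> V -> W)
    (x v : V) (dF : I -> W) : (forall i, is_derive x v (F i) (dF i)) ->
  is_derive x v (fun y => \sum_i F i y) (\sum_i dF i).
Proof.
move=> FdF; have h : is_derive x v (\sum_i F i) (\sum_i dF i).
  apply: (big_ind2 (fun f d => is_derive x v f d)) => //.
    exact: is_derive_cst.
  by move=> f df g dg fd gd; exact: is_deriveD.
by apply: eq_is_derive_line h => t; rewrite fct_sumE.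
Qed.

End DirectionalDerivatives.

Lemma cvg_bigsum (R : realType) (T : Type) (F : set_system T) {FF : Filter F}
    (W : normedModType R)
    (I : finType) (g : I -> T -> W) (l : I -> W) :
  (forall i, g i t @[t --> F] --> l i) -> (\sum_i g i t) @[t --> F] --> \sum_i l i.
Proof. by move=> gl; apply: cvg_big => //; exact: add_continuous. Qed.

Lemma cvg_sum_scale (R : realType) (T : Type) (F : set_system T) {FF : Filter F}
    (W : normedModType R)
    (I : finType) (g : I -> T -> R) (l : I -> R) (w : I -> W) :
  (forall i, g i t @[t --> F] --> l i) -> (\sum_i g i t *: w i) @[t --> F] --> \sum_i l i *: w i.
Proof.
by move=> gl; apply: cvg_bigsum => i; exact: cvgZr_tmp.
Qed.


Section ContinuousOperations.
Variables (R : realType) (V : topologicalType) (W : normedModType R).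

Lemma continuous_mul (f g : V -> R) : continuous f -> continuous g ->
  continuous (fun x => f x * g x).
Proof. by move=> cf cg x; apply: cvgM; [exact: cf | exact: cg]. Qed.

Lemma continuous_add (f g : V -> W) : continuous f -> continuous g ->
  continuous (fun x => f x + g x).
Proof. by move=> cf cg x; apply: cvgD; [exact: cf | exact: cg]. Qed.

Lemma continuous_sub (f g : V -> W) : continuous f -> continuous g ->
  continuous (fun x => f x - g x).
Proof. by move=> cf cg x; apply: cvgB; [exact: cf | exact: cg]. Qed.

Lemma continuous_scale (f : V -> R) (g : V -> W) : continuous f -> continuous g ->
  continuous (fun x => f x *: g x).
Proof. by move=> cf cg x; apply: cvgZ; [exact: cf | exact: cg]. Qed.

Lemma continuous_bigsum (I : finType) (g : I -> V -> W) :
  (forall i, continuous (g i)) -> continuous (fun x => \sum_i g i x).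
Proof. by move=> cg x; apply: cvg_bigsum => i; exact: cg. Qed.

Lemma continuous_const (w : W) : continuous (fun _ : V => w).
Proof. by move=> x; exact: cvg_cst. Qed.

Lemma continuous_lincomb (a b : R) (f g : V -> W) : continuous f -> continuous g ->
  continuous (fun x => a *: f x + b *: g x).
Proof. by move=> cf cg x; apply: cvgD; apply: cvgZl_tmp; [exact: cf | exact: cg]. Qed.

End ContinuousOperations.

Lemma continuous_compose (U V W : topologicalType) (f : U -> V) (g : V -> W) :
  continuous f -> continuous g -> continuous (fun x => g (f x)).
Proof. by move=> cf cg x; apply: continuous_comp; [exact: cf | exact: cg]. Qed.

(** * Derivatives and Laplacian of separated axial functions *)

Section CliffordCalculus.
Variables (R : realType) (n : nat).
Local Notation C := (clifford R n).
Local Notation E := 'rV[R]_n.+1.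
Implicit Types (x y v : E) (a b w : C) (A B : {set 'I_n}) (i j : 'I_n).

Lemma cl_ext a b : (forall A, cl_coef a A = cl_coef b A) -> a = b.
Proof. by move=> ab; rewrite [a]cl_basisE [b]cl_basisE; apply: eq_bigr => A _; rewrite ab. Qed.

Lemma cl_coefN a A : cl_coef (- a) A = - cl_coef a A.
Proof. by rewrite /cl_coef mxE. Qed.

Lemma cl_coef0 A : cl_coef (0 : C) A = 0.
Proof. by rewrite /cl_coef mxE. Qed.

Lemma cl_coefMn a k A : cl_coef (a *+ k) A = k%:R * cl_coef a A.
Proof. by rewrite -scaler_nat cl_coefZ. Qed.

Lemma cl_coef_sum (I : Type) (s : seq I) (P : pred I) (F : I -> C) A :
  cl_coef (\sum_(k <- s | P k) F k) A = \sum_(k <- s | P k) cl_coef (F k) A.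
Proof.
by apply: (big_morph (fun a => cl_coef a A)) => [a b|]; [exact: cl_coefD | exact: cl_coef0].
Qed.

Lemma cl_coef_continuous A : continuous (fun a : C => cl_coef a A).
Proof. exact: coord_continuous. Qed.

Lemma cl_linear_continuous (W : normedModType R) (L : C -> W) :
  linear L -> continuous L.
Proof.
move=> Ll a; have L0 : L 0 = 0.
  by apply: (addrI (L 0)); rewrite -[X in X + _ = _]scale1r -Ll scale1r !addr0.
have [w /funext ->] : exists w : {set 'I_n} -> W, forall b, L b = \sum_A cl_coef b A *: w A.
  exists (fun A => L (cl_basis R A)) => b.
  rewrite {1}[b]cl_basisE; elim/big_rec2: _ => [//|A u w _ <-].
  exact: Ll.
exact: (@cvg_sum_scale _ _ _ (nbhs_filter a) _ _ _ _ w (fun A => @cl_coef_continuous A a)).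
Qed.

Lemma cl_mulr_linear a : linear (fun b : C => b * a).
Proof. by move=> k u w; rewrite mulrDl -scalerAl. Qed.

Lemma is_derive_cl_linear (V W : normedModType R) (L : C -> W) (f : V -> C)
    (z u : V) (df : C) :
  linear L -> is_derive z u f df -> is_derive z u (fun p => L (f p)) (L df).
Proof. by move=> Ll; apply: is_derive_linear => //; exact: cl_linear_continuous. Qed.

Definition vsq x : R := \sum_(i < n) x ord0 (lift ord0 i) ^+ 2.

Lemma vsq_ge0 x : 0 <= vsq x.
Proof. by apply: sumr_ge0 => i _; exact: sqr_ge0. Qed.

Lemma vecnormE x : vecnorm x ^+ 2 = vsq x.
Proof. exact/sqr_sqrtr/vsq_ge0. Qed.

Lemma vecpart_sqr x : vecpart x * vecpart x = - (vsq x)%:A.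
Proof.
have E : vecpart x * vecpart x =
    \sum_i \sum_j (x ord0 (lift ord0 i) * x ord0 (lift ord0 j)) *: (cl_gen i * cl_gen j : C).
  rewrite mulr_suml; apply: eq_bigr => i _; rewrite mulr_sumr; apply: eq_bigr => j _.
  by rewrite -scalerAl -scalerAr scalerA.
(* Doubling symmetrises the sum over pairs, so that the off-diagonal terms cancel by
   anticommutation. *)
have E2 : (2 : R) *: (vecpart x * vecpart x) = (2 : R) *: (- (vsq x)%:A).
  rewrite scaler_nat mulr2n {1}E exchange_big /= {1}E -big_split /=.
  rewrite scalerN scalerA /vsq mulr_sumr scaler_suml -sumrN; apply: eq_bigr => i _.
  rewrite -big_split (bigD1 i) //= big1 ?addr0 => [|j ji].
    by rewrite cl_gen_sqr -scalerDr -mulr2n -scaler_nat scalerA scalerN -expr2 mulrC.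
  by rewrite mulrC -scalerDr cl_gen_anticomm // scaler0.
by move: E2 => /(congr1 (fun w => 2^-1 *: w)); rewrite !scalerA mulVf ?scale1r // pnatr_eq0.
Qed.

Lemma vecpart_double x k : vecpart x ^+ k.*2 = ((- vsq x) ^+ k)%:A.
Proof.
elim: k => [|k IH]; first by rewrite !expr0 scale1r.
rewrite doubleS !exprS IH mulrA vecpart_sqr mulNr -scalerAl mul1r.
by rewrite scalerA -scaleNr mulNr.
Qed.

Lemma is_derive_coord (k : 'I_n.+1) x v :
  is_derive x v (fun y : E => y ord0 k) (v ord0 k).
Proof.
apply: (@is_derive_linear _ _ _ _ (fun y : E => y ord0 k : R^o) id).
- by move=> a u w; rewrite !mxE.
- exact: coord_continuous.
Qed.

Lemma is_derive_scpart x v : is_derive x v (@scpart R n) (scpart v).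
Proof. exact: is_derive_coord. Qed.

Lemma is_derive_vecpart x v : is_derive x v (@vecpart R n) (vecpart v).
Proof. by apply: is_derive_bigsum => i; apply: is_derive_scalel; exact: is_derive_coord. Qed.

Lemma is_derive_vsq x v : is_derive x v vsq
  (\sum_(i < n) 2 * (x ord0 (lift ord0 i) * v ord0 (lift ord0 i))).
Proof.
apply: is_derive_bigsum => i.
have := is_derive_mul (is_derive_coord (lift ord0 i) x v) (is_derive_coord (lift ord0 i) x v).
rewrite [X in is_derive _ _ _ X -> _](_ : _ =
  2 * (x ord0 (lift ord0 i) * v ord0 (lift ord0 i))); last by ring.
by apply: eq_is_derive_line => h; rewrite expr2.
Qed.

Definition e0 : E := delta_mx ord0 ord0.
Definition ei i : E := delta_mx ord0 (lift ord0 i).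

Lemma scpart_e0 : scpart e0 = 1. Proof. by rewrite /scpart mxE !eqxx. Qed.
Lemma ei_coord i j : ei i ord0 (lift ord0 j) = (i == j)%:R.
Proof. by rewrite mxE /= (inj_eq lift_inj) eq_sym. Qed.
Lemma e0_coord i : e0 ord0 (lift ord0 i) = 0.
Proof. by rewrite mxE. Qed.
Lemma vecpart_e0 : vecpart e0 = 0.
Proof. by rewrite /vecpart big1 // => i _; rewrite e0_coord scale0r. Qed.
Lemma vecpart_ei i : vecpart (ei i) = cl_gen i.
Proof.
rewrite /vecpart (bigD1 i) //= ei_coord eqxx scale1r big1 ?addr0 // => j ji.
by rewrite ei_coord eq_sym (negPf ji) scale0r.
Qed.

(** The separated ansatz. Power series in [vsq x] rather than in [vecnorm x] keep the function
    smooth across the real axis. *)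
Definition prof (ta si : R -> R) (c q : nat -> R) : E -> C := fun x =>
  (ta (scpart x) * psum c (vsq x))%:A + (si (scpart x) * psum q (vsq x)) *: vecpart x.

Lemma is_derive_scaleC (f : E -> R) (g : E -> C) x v (df : R) (dg : C) :
  is_derive x v f df -> is_derive x v g dg ->
  is_derive x v (fun y => f y *: g y) (df *: g x + f x *: dg).
Proof.
move=> fx gx.
have h A : is_derive x v (fun y => (f y * cl_coef (g y) A) *: cl_basis R A)
    ((df * cl_coef (g x) A + f x * cl_coef dg A) *: cl_basis R A).
  apply/is_derive_scalel/is_derive_mul => //.
  apply: (is_derive_cl_linear (W := R^o) (L := fun b => cl_coef b A : R^o)) gx => a u w.
  by rewrite cl_coefD cl_coefZ.
have := is_derive_bigsum h.
have E (k : R) (b : C) : k *: b = \sum_A (k * cl_coef b A) *: cl_basis R A.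
  by rewrite {1}[b]cl_basisE scaler_sumr; apply: eq_bigr => A _; rewrite scalerA.
rewrite E [f x *: dg]E -big_split /=; under eq_bigr do rewrite scalerDl.
by apply: eq_is_derive_line => t; rewrite E.
Qed.

Lemma is_derive_profile0 (f df : R -> R) (b : nat -> R) x :
  (forall t : R, is_derive t 1 f (df t)) -> entire b ->
  is_derive x e0 (fun y => f (scpart y) * psum b (vsq y)) (df (scpart x) * psum b (vsq x)).
Proof.
move=> fdf eb.
have V0 : is_derive x e0 vsq 0.
  have := is_derive_vsq x e0; rewrite big1 // => i _.
  by rewrite e0_coord !mulr0.
have S0 : is_derive x e0 (@scpart R n) 1.
  by rewrite -scpart_e0; exact: is_derive_scpart.
have := is_derive_mul (is_derive_chain (fdf _) S0) (is_derive_chain (is_derive_psum _ eb) V0).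
by rewrite mulr0 mulr0 addr0 mulr1.
Qed.

Lemma is_derive_profilei (f : R -> R) (b : nat -> R) x i : entire b ->
  is_derive x (ei i) (fun y => f (scpart y) * psum b (vsq y))
    (2 * x ord0 (lift ord0 i) * (f (scpart x) * psum (pseries_diffs b) (vsq x))).
Proof.
move=> eb.
have Vi : is_derive x (ei i) vsq (2 * x ord0 (lift ord0 i)).
  have := is_derive_vsq x (ei i); rewrite (bigD1 i) //= ei_coord eqxx mulr1 big1 ?addr0 //.
  by move=> j ji; rewrite ei_coord eq_sym (negPf ji) !mulr0.
have := is_derive_mul (is_derive_cst (f (scpart x)) x (ei i))
  (is_derive_chain (is_derive_psum _ eb) Vi).
rewrite mul0r add0r /cst mulrA mulrC.
apply: eq_is_derive_line => h; congr (f _ * _).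
by rewrite /scpart !mxE mulr0 add0r.
Qed.

Lemma is_derive_prof0 (ta dta si dsi : R -> R) c q x :
  (forall t : R, is_derive t 1 ta (dta t)) -> (forall t : R, is_derive t 1 si (dsi t)) ->
  entire c -> entire q ->
  is_derive x e0 (prof ta si c q) (prof dta dsi c q x).
Proof.
move=> dta1 dsi1 ec eq_.
have := is_deriveD (is_derive_scalel (1 : C) (is_derive_profile0 x dta1 ec))
  (is_derive_scaleC (is_derive_profile0 x dsi1 eq_) (is_derive_vecpart x e0)).
rewrite vecpart_e0 scaler0 addr0; exact: eq_is_derive_line.
Qed.

Lemma is_derive_profi (ta si : R -> R) c q x i : entire c -> entire q ->
  is_derive x (ei i) (prof ta si c q)
    ((2 * x ord0 (lift ord0 i)) *: prof ta si (pseries_diffs c) (pseries_diffs q) x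
     + (si (scpart x) * psum q (vsq x)) *: cl_gen i).
Proof.
move=> ec eq_.
have := is_deriveD (is_derive_scalel (1 : C) (is_derive_profilei ta x i ec))
  (is_derive_scaleC (is_derive_profilei si x i eq_) (is_derive_vecpart x (ei i))).
rewrite vecpart_ei addrA {2}/prof scalerDr !scalerA; exact: eq_is_derive_line.
Qed.

Lemma partial0_prof (ta dta si dsi : R -> R) c q :
  (forall t : R, is_derive t 1 ta (dta t)) -> (forall t : R, is_derive t 1 si (dsi t)) ->
  entire c -> entire q ->
  partial ord0 (prof ta si c q) = prof dta dsi c q.
Proof.
move=> dta1 dsi1 ec eq_; apply/funext => x.
exact: (@derive_val _ _ _ _ _ _ _ (is_derive_prof0 x dta1 dsi1 ec eq_)).
Qed.

Lemma partiali_prof (ta si : R -> R) c q i : entire c -> entire q ->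
  partial (lift ord0 i) (prof ta si c q) = fun x =>
    (2 * x ord0 (lift ord0 i)) *: prof ta si (pseries_diffs c) (pseries_diffs q) x
     + (si (scpart x) * psum q (vsq x)) *: cl_gen i.
Proof.
move=> ec eq_; apply/funext => x.
exact: (@derive_val _ _ _ _ _ _ _ (is_derive_profi ta si x i ec eq_)).
Qed.

(** In the vector variables, with [s = |xv| ^ 2], the Laplacian sends [f(s)] to [4 s f'' + 2 n f']
    and [f(s) xv] to [(4 s f'' + (2 n + 4) f') xv]. The second derivative in [t] contributes the
    factor [ka]. *)
Lemma laplacian_prof (ta dta si dsi : R -> R) (ka : R) c q :
  (forall t : R, is_derive t 1 ta (dta t)) -> (forall t : R, is_derive t 1 dta (ka * ta t)) ->
  (forall t : R, is_derive t 1 si (dsi t)) -> (forall t : R, is_derive t 1 dsi (ka * si t)) ->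
  entire c -> entire q ->
  laplacian (prof ta si c q) =
  prof ta si (fun k => ka * c k + (4 * k%:R + 2 * n%:R) * pseries_diffs c k)
             (fun k => ka * q k + (4 * k%:R + 2 * n%:R + 4) * pseries_diffs q k).
Proof.
move=> dta1 dta2 dsi1 dsi2 ec eq_; apply/funext => x.
have ec1 := entire_diffs ec; have eq1 := entire_diffs eq_.
rewrite /laplacian big_ord_recl (partial0_prof dta1 dsi1) // (partial0_prof dta2 dsi2) //.
set t := scpart x; set s := vsq x; set c1 := pseries_diffs c in ec1 *.
set q1 := pseries_diffs q in eq1 *.
pose F1 := prof ta si c1 q1 x; pose F2 := prof ta si (pseries_diffs c1) (pseries_diffs q1) x.
have -> : \sum_(i < n) partial (lift ord0 i) (partial (lift ord0 i) (prof ta si c q)) x =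
    (2 * n%:R) *: F1 + (4 * s) *: F2 + (4 * (si t * psum q1 s)) *: vecpart x.
  have E i : partial (lift ord0 i) (partial (lift ord0 i) (prof ta si c q)) x =
      (2 : R) *: F1 + (4 * x ord0 (lift ord0 i) ^+ 2) *: F2 +
      (4 * (si t * psum q1 s)) *: (x ord0 (lift ord0 i) *: cl_gen i).
    rewrite partiali_prof //.
    have d1 : is_derive x (ei i) (fun y : E => 2 * y ord0 (lift ord0 i)) 2.
      have := is_deriveZ (2 : R) (is_derive_coord (lift ord0 i) x (ei i)).
      by rewrite ei_coord eqxx /GRing.scale /= mulr1.
    have := is_deriveD (is_derive_scaleC d1 (is_derive_profi ta si x i ec1 eq1))
      (is_derive_scalel (cl_gen i : C) (is_derive_profilei si x i eq_)).
    move=> d2; rewrite [LHS](@derive_val _ _ _ _ _ _ _ d2).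
    rewrite -/F1 -/F2 -/q1 -/t -/s; apply: cl_ext => A.
    by rewrite !(cl_coefD, cl_coefZ); ring.
  under eq_bigr do rewrite E; rewrite !big_split /=.
  rewrite sumr_const card_ord -scaler_nat scalerA -scaler_suml -mulr_sumr -scaler_sumr.
  by congr (_ *: _ + _ + _); rewrite mulrC.
rewrite /F1 /F2 /prof -/t -/s.
have P (b : nat -> R) (al : R) : entire b ->
    psum (fun k => ka * b k + (4 * k%:R + al) * pseries_diffs b k) s =
    ka * psum b s + al * psum (pseries_diffs b) s
      + 4 * s * psum (pseries_diffs (pseries_diffs b)) s.
  move=> eb; have eb1 := entire_diffs eb.
  have e1 := entireZ ka eb; have e2 := entireZ al eb1.
  have e3 := entireZ 4 (entire_mulnat eb1).
  rewrite (_ : (fun k => _) = fun k => (ka * b k + al * pseries_diffs b k)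
    + 4 * (k%:R * pseries_diffs b k)); last by apply/funext => k; ring.
  rewrite psumD ?psumD ?psumZ ?psum_mulnat ?mulrA //; [exact: entire_mulnat | exact: entireD].
rewrite (P c (2 * n%:R)) // (_ : (fun k => ka * q k + _) =
  fun k => ka * q k + (4 * k%:R + (2 * n%:R + 4)) * pseries_diffs q k); last first.
  by apply/funext => k; rewrite !addrA.
rewrite (P q (2 * n%:R + 4)) // -/c1 -/q1.
by apply: cl_ext => A; rewrite !(cl_coefD, cl_coefZ); ring.
Qed.

End CliffordCalculus.

(** * Splitting a series into its even and odd terms *)

Section Interleaving.
Variables (R : realType) (V : normedModType R).

Definition interleave (a b : nat -> V) j := if odd j then b j./2 else a j./2.

Lemma half_cvgn : (fun N => N./2) @ \oo --> \oo.
Proof.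
move=> A [N _ NA]; exists N.*2 => // k /= Nk; apply: NA => /=.
by rewrite -[N]doubleK half_leq.
Qed.

Lemma uphalf_cvgn : (fun N => uphalf N) @ \oo --> \oo.
Proof.
move=> A [N _ NA]; exists N.*2 => // k /= Nk; apply: NA => /=.
by rewrite -[N]doubleK uphalfE half_leq // (leq_trans Nk).
Qed.

Lemma series_interleave a b N :
  series (interleave a b) N = series a (uphalf N) + series b N./2.
Proof.
elim: N => [|N IH]; first by rewrite /series /= !big_geq // addr0.
rewrite seriesSr IH /interleave /= !uphalf_half; case: (boolP (odd N)) => oN /=.
  by rewrite add1n [series b _.+1]seriesSr addrA.
by rewrite add0n seriesSr addrAC.
Qed.

Lemma cvg_series_interleave a b (la lb : V) :
  series a @ \oo --> la -> series b @ \oo --> lb ->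
  series (interleave a b) @ \oo --> la + lb.
Proof.
move=> ca cb; rewrite (_ : series _ = fun N => series a (uphalf N) + series b N./2).
  by apply: cvgD; [exact: cvg_comp uphalf_cvgn ca | exact: cvg_comp half_cvgn cb].
by apply/funext => N; exact: series_interleave.
Qed.

Lemma cvg_series_even (u : nat -> V) (l : V) :
  series u @ \oo --> l -> (forall k, u k.*2.+1 = 0) ->
  series (fun k => u k.*2) @ \oo --> l.
Proof.
move=> cu u0.
rewrite (_ : series _ = fun K => series u K.*2).
  apply: cvg_comp cu => A [N _ NA]; exists N => // k /= Nk; apply: NA => /=.
  by rewrite -addnn (leq_trans Nk) // leq_addr.
apply/funext; elim=> [|K IH]; first by rewrite /series /= !big_geq.
by rewrite seriesSr IH doubleS !seriesSr u0 addr0.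
Qed.

Lemma cvg_series_odd (u : nat -> V) (l : V) :
  series u @ \oo --> l -> (forall k, u k.*2 = 0) ->
  series (fun k => u k.*2.+1) @ \oo --> l.
Proof.
move=> cu u0.
rewrite (_ : series _ = fun K => series u K.*2).
  apply: cvg_comp cu => A [N _ NA]; exists N => // k /= Nk; apply: NA => /=.
  by rewrite -addnn (leq_trans Nk) // leq_addr.
apply/funext; elim=> [|K IH]; first by rewrite /series /= !big_geq.
by rewrite seriesSr IH doubleS !seriesSr u0 addr0.
Qed.

End Interleaving.

(** * Monogenicity of separated axial functions *)

Section ProfileMonogenic.
Variables (R : realType) (n : nat).
Local Notation C := (clifford R n).
Local Notation E := 'rV[R]_n.+1.
Implicit Types (x y v : E) (c q : nat -> R) (ta si : R -> R).

Lemma scpart_continuous : continuous (@scpart R n).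
Proof. exact: coord_continuous. Qed.

Lemma vecpart_continuous : continuous (@vecpart R n).
Proof.
apply: continuous_bigsum => i; apply: continuous_scale; last exact: continuous_const.
exact: coord_continuous.
Qed.

Lemma vsq_continuous : continuous (@vsq R n).
Proof.
apply: continuous_bigsum => i.
rewrite (_ : (fun y : E => _) = fun y => y ord0 (lift ord0 i) * y ord0 (lift ord0 i)) //.
by apply: continuous_mul; exact: coord_continuous.
Qed.

Lemma profile_continuous (f : R -> R) (b : nat -> R) : continuous f -> entire b ->
  continuous (fun x => f (scpart x) * psum b (vsq x)).
Proof.
move=> cf eb; apply: continuous_mul.
  exact: (continuous_compose scpart_continuous cf).
exact: (continuous_compose vsq_continuous (continuous_psum eb)).
Qed.

Lemma prof_continuous ta si c q : continuous ta -> continuous si ->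
  entire c -> entire q -> continuous (@prof R n ta si c q).
Proof.
move=> cta csi ec eq_; apply: continuous_add; apply: continuous_scale.
- exact: profile_continuous.
- exact: continuous_const.
- exact: profile_continuous.
- exact: vecpart_continuous.
Qed.

Lemma is_derive_continuous (f df : R -> R) :
  (forall t : R, is_derive t 1 f (df t)) -> continuous f.
Proof.
by move=> fdf t; apply/differentiable_continuous/derivable1_diffP; have [] := fdf t.
Qed.

Lemma C1_on_prof ta dta si dsi c q :
  (forall t : R, is_derive t 1 ta (dta t)) -> (forall t : R, is_derive t 1 si (dsi t)) ->
  continuous dta -> continuous dsi -> entire c -> entire q ->
  C1_on setT (@prof R n ta si c q).
Proof.
move=> dta1 dsi1 cdta cdsi ec eq_ i x _.
have cta := is_derive_continuous dta1; have csi := is_derive_continuous dsi1.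
case: (unliftP ord0 i) => [j|] ->; split.
- by have [] := is_derive_profi ta si x j ec eq_.
- rewrite partiali_prof //; move: x; apply: continuous_add; apply: continuous_scale.
  + by apply: continuous_mul; [exact: continuous_const | exact: coord_continuous].
  + by apply: prof_continuous => //; exact: entire_diffs.
  + exact: profile_continuous.
  + exact: continuous_const.
- by have [] := is_derive_prof0 x dta1 dsi1 ec eq_.
- by rewrite (partial0_prof n dta1 dsi1) //; move: x; exact: prof_continuous.
Qed.

(** Summing [cl_gen i * x_i] rebuilds [vecpart x], and multiplication by it exchanges the two
    components because its square is [- vsq x]. The term with [n] collects the [n] squares
    [cl_gen i ^ 2 = -1]. *)
Lemma dirac_profi ta si c q x :
  \sum_(i < n) cl_gen i * ((2 * x ord0 (lift ord0 i)) *: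
       prof ta si (pseries_diffs c) (pseries_diffs q) x
     + (si (scpart x) * psum q (vsq x)) *: cl_gen i) =
  (2 * (ta (scpart x) * psum (pseries_diffs c) (vsq x))) *: vecpart x
  - (si (scpart x) * (2 * vsq x * psum (pseries_diffs q) (vsq x) +
      n%:R * psum q (vsq x))) *: (1 : C).
Proof.
set F1 := prof _ _ _ _ _.
under eq_bigr do rewrite mulrDr -!scalerAr cl_gen_sqr.
rewrite big_split /= sumr_const card_ord.
have -> : \sum_(i < n) (2 * x ord0 (lift ord0 i)) *: (cl_gen i * F1) = (2 : R) *: (vecpart x * F1).
  rewrite mulr_suml scaler_sumr; apply: eq_bigr => i _.
  by rewrite -scalerAl scalerA.
have -> : vecpart x * F1 = (ta (scpart x) * psum (pseries_diffs c) (vsq x)) *: vecpart x +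
    (si (scpart x) * psum (pseries_diffs q) (vsq x)) *: - (vsq x)%:A.
  by rewrite /F1 /prof mulrDr -!scalerAr mulr1 vecpart_sqr.
apply: cl_ext => A; rewrite !(cl_coefD, cl_coefZ, cl_coefN, cl_coefMn); ring.
Qed.

Lemma cauchy_riemann_prof ta dta si dsi c q x :
  (forall t : R, is_derive t 1 ta (dta t)) -> (forall t : R, is_derive t 1 si (dsi t)) ->
  entire c -> entire q ->
  cauchy_riemann (prof ta si c q) x = prof dta dsi c q x +
  ((2 * (ta (scpart x) * psum (pseries_diffs c) (vsq x))) *: vecpart x
  - (si (scpart x) * (2 * vsq x * psum (pseries_diffs q) (vsq x) +
      n%:R * psum q (vsq x))) *: (1 : C)).
Proof.
move=> dta1 dsi1 ec eq_; rewrite /cauchy_riemann (partial0_prof n dta1 dsi1) //.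
rewrite -dirac_profi; congr (_ + _); apply: eq_bigr => i _.
by rewrite partiali_prof.
Qed.

Lemma axial_form_prof ta si c q : axial_form setT (@prof R n ta si c q).
Proof.
exists (fun t r => (ta t * psum c (r ^+ 2))%:A), (fun t r => (si t * (r * psum q (r ^+ 2)))%:A).
split=> [t r|t r|x _]; first by rewrite sqrrN.
  by rewrite sqrrN mulNr mulrN scaleNr.
rewrite vecnormE /prof -scalerAr mulr1 scalerA; congr (_ + _).
(* On the real axis the inverse of [vecnorm x] is 0 by convention, but [vecpart x] is 0 as well, so
   both sides vanish. *)
have [r0|r0] := eqVneq (vecnorm x) 0; last first.
  by congr (_ *: _); rewrite [vecnorm x * _]mulrC mulrA mulfK.
suff -> : vecpart x = 0 by rewrite !scaler0.
have s0 : vsq x = 0 by rewrite -vecnormE r0 expr0n.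
rewrite /vecpart big1 // => i _; apply/eqP; rewrite scaler_eq0; apply/orP; left.
move: s0 => /eqP; rewrite psumr_eq0 => [|j _]; last exact: sqr_ge0.
by move=> /allP/(_ i); rewrite mem_index_enum sqrf_eq0; apply.
Qed.

Lemma series_prof ta si c q : entire c -> entire q ->
  exists f : nat -> R -> C, forall x,
    series (fun j => vecpart x ^+ j * f j (scpart x)) @ \oo --> prof ta si c q x.
Proof.
move=> ec eq_.
(* The signs come from [vsq x ^ k = (-1) ^ k * vecpart x ^ k.*2]. *)
exists (fun j t => interleave (fun k => ((-1) ^+ k * (ta t * c k))%:A : C)
  (fun k => ((-1) ^+ k * (si t * q k))%:A : C) j) => x.
pose a k : C := (ta (scpart x) * (c k * vsq x ^+ k))%:A.
pose b k : C := (si (scpart x) * (q k * vsq x ^+ k)) *: vecpart x.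
rewrite (_ : (fun j => _) = interleave a b).
  have S (f : R) (d : nat -> R) (w : C) : entire d ->
      series (fun k => (f * (d k * vsq x ^+ k)) *: w) @ \oo --> (f * psum d (vsq x)) *: w.
    move=> ed; rewrite (_ : series _ = fun N => (f * pseries d (vsq x) N) *: w).
      by apply: cvgZr_tmp; apply: cvgMr; exact: psum_cvg.
    by apply/funext => N; rewrite /pseries /series /= mulr_sumr scaler_suml.
  by apply: cvg_series_interleave; exact: S.
apply/funext => j; rewrite /interleave -{1}(odd_double_half j).
have sg k (z : R) : (- vsq x) ^+ k * ((-1) ^+ k * z) = z * vsq x ^+ k.
  by rewrite mulrA -exprMn mulrN1 opprK mulrC.
case: (odd j); rewrite ?add1n ?add0n ?exprS vecpart_double.
  by rewrite !mulr_algr scalerA mulrC sg /b mulrA.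
by rewrite mulr_algr scalerA mulrC sg /a mulrA.
Qed.

Lemma prof_realpoint ta si c q t : entire c ->
  prof ta si c q (realpoint n t) = (ta t * c 0%N)%:A.
Proof.
move=> ec; have sc : scpart (realpoint n t) = t by rewrite /scpart !mxE !eqxx mulr1.
have co i : (realpoint n t) ord0 (lift ord0 i) = 0 by rewrite !mxE mulr0.
have s0 : vsq (realpoint n t) = 0.
  by rewrite /vsq big1 // => i _; rewrite co expr0n.
have v0 : vecpart (realpoint n t) = 0.
  by rewrite /vecpart big1 // => i _; rewrite co scale0r.
by rewrite /prof sc s0 v0 scaler0 addr0 psum0.
Qed.

(** The last two hypotheses are the Cauchy-Riemann system after cancelling the common factors [si t]
    and [ta t], coefficient by coefficient. *)
Lemma is_gck_prof ta si la mu c q :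
  (forall t : R, is_derive t 1 ta (mu * si t)) -> (forall t : R, is_derive t 1 si (la * ta t)) ->
  entire c -> entire q ->
  (forall k, mu * c k = (2 * k%:R + n%:R) * q k) ->
  (forall k, la * q k = - 2 * pseries_diffs c k) ->
  is_gck setT (fun t => (ta t * c 0%N)%:A) (@prof R n ta si c q).
Proof.
move=> dta dsi ec eq_ E1 E2; split=> [| |t _].
- split.
  + apply: (C1_on_prof dta dsi _ _ ec eq_) => t; apply: cvgMr.
      exact: is_derive_continuous dsi t.
    exact: is_derive_continuous dta t.
  + move=> x _; rewrite (cauchy_riemann_prof x dta dsi) //.
    have P1 : mu * psum c (vsq x) =
       2 * vsq x * psum (pseries_diffs q) (vsq x) + n%:R * psum q (vsq x).
      by rewrite -psum_affine // -psumZ //; congr psum; apply/funext => k; exact: E1.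
    have P2 : la * psum q (vsq x) = - 2 * psum (pseries_diffs c) (vsq x).
      rewrite -!psumZ //; last exact: entire_diffs.
      by congr psum; apply/funext => k; exact: E2.
    rewrite -P1 /prof; apply: cl_ext => A; rewrite !(cl_coefD, cl_coefZ, cl_coefN).
    have -> : la * ta (scpart x) * psum q (vsq x) = ta (scpart x) * (la * psum q (vsq x)) by ring.
    by rewrite P2 cl_coef0; ring.
  + exact: axial_form_prof.
- by have [f fP] := series_prof ta si ec eq_; exists f => x _; exact: fP.
- exact: prof_realpoint.
Qed.

End ProfileMonogenic.

(** * Uniqueness of the generalized CK-extension *)

Section GckUniqueness.
Variables (R : realType) (n : nat).
Local Notation C := (clifford R n).
Local Notation E := 'rV[R]_n.+1.
Implicit Types (x y v : E) (F G H : E -> C) (f g : R -> C).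

(** Serves twice: to reduce uniqueness to the extension of zero, and to assemble the extensions of
    the squares. *)
Lemma is_gck_lin (a b : R) f F g G : is_gck setT f F -> is_gck setT g G ->
  is_gck setT (fun t => a *: f t + b *: g t) (fun x => a *: F x + b *: G x).
Proof.
move=> [[CF MF [AF [BF [AFe BFo FE]]]] [sF hF] fF] [[CG MG [AG [BG [AGe BGo GE]]]] [sG hG] gG].
have pE i : partial i (fun x => a *: F x + b *: G x) =
    fun x => a *: partial i F x + b *: partial i G x.
  apply/funext => x.
  have [/derivableP dF _] := CF i x I; have [/derivableP dG _] := CG i x I.
  exact: (@derive_val _ _ _ _ _ _ _ (is_deriveD (is_deriveZ a dF) (is_deriveZ b dG))).
split=> [| |t _]; last by rewrite fF ?gG.
- split.
  + move=> i x _; split.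
      have [/derivableP dF _] := CF i x I; have [/derivableP dG _] := CG i x I.
      by have [] := is_deriveD (is_deriveZ a dF) (is_deriveZ b dG).
    rewrite pE; have cF : continuous (partial i F) by move=> y; have [] := CF i y I.
    have cG : continuous (partial i G) by move=> y; have [] := CG i y I.
    exact: (@continuous_lincomb _ _ _ a b _ _ cF cG x).
  + move=> x _; rewrite /cauchy_riemann !pE.
    have cF := MF x I; have cG := MG x I; rewrite /cauchy_riemann in cF cG.
    transitivity (a *: (partial ord0 F x + \sum_(i < n) cl_gen i * partial (lift ord0 i) F x)
      + b *: (partial ord0 G x + \sum_(i < n) cl_gen i * partial (lift ord0 i) G x)).
      rewrite !scalerDr addrACA; congr (_ + _); rewrite !scaler_sumr -big_split /=.
      by apply: eq_bigr => i _; rewrite pE mulrDr !scalerAr.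
    by rewrite cF cG !scaler0 addr0.
  + exists (fun t r => a *: AF t r + b *: AG t r), (fun t r => a *: BF t r + b *: BG t r).
    split=> [t r|t r|x _]; first by rewrite AFe AGe.
      by rewrite BFo BGo !scalerN opprD.
    by rewrite FE // GE // !scalerDr mulrDr -!scalerAr addrACA.
- exists (fun j t => a *: sF j t + b *: sG j t) => x _.
  rewrite (_ : series _ = fun N => a *: series (fun j => vecpart x ^+ j * sF j (scpart x)) N
    + b *: series (fun j => vecpart x ^+ j * sG j (scpart x)) N).
    by apply: cvgD; apply: cvgZl_tmp; [exact: hF | exact: hG].
  apply/funext => N; rewrite /series /= !scaler_sumr -big_split /=.
  by apply: eq_bigr => j _; rewrite mulrDr !scalerAr.
Qed.

Variable (i0 : 'I_n).
Let om : C := cl_gen i0.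

Lemma om2 : om * om = -1. Proof. exact: cl_gen_sqr. Qed.

(** The point [t + r * om] of one complex plane. The [f j] depend on the scalar part only, so this
    plane already determines them. *)
Definition pt (t r : R) : E := realpoint n t + r *: ei R i0.

Lemma scpart_pt t r : scpart (pt t r) = t.
Proof. by rewrite /scpart /pt /ei !mxE eqxx /= mulr1 mulr0 addr0. Qed.

Lemma coord_pt t r i : pt t r ord0 (lift ord0 i) = r * (i0 == i)%:R.
Proof. by rewrite /pt mxE [X in X + _]mxE [X in _ * X]mxE mulr0 add0r mxE ei_coord. Qed.

Lemma vecpart_pt t r : vecpart (pt t r) = r *: om.
Proof.
rewrite /vecpart (bigD1 i0) //= coord_pt eqxx mulr1 big1 ?addr0 // => i ii0.
by rewrite coord_pt eq_sym (negPf ii0) mulr0 scale0r.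
Qed.

Lemma vsq_pt t r : vsq (pt t r) = r ^+ 2.
Proof.
rewrite /vsq (bigD1 i0) //= coord_pt eqxx mulr1 big1 ?addr0 // => i ii0.
by rewrite coord_pt eq_sym (negPf ii0) mulr0 expr0n.
Qed.

Lemma pt_shift t r h : h *: e0 R n + pt t r = pt (t + h) r.
Proof. by rewrite /pt /realpoint /e0 addrA -scalerDl [h + t]addrC. Qed.

Lemma pt_continuous r : continuous (fun t => pt t r).
Proof.
apply: continuous_add; last exact: continuous_const.
by apply: continuous_scale; [move=> x; exact: cvg_id | exact: continuous_const].
Qed.

Section Coefficients.
Variables (H : E -> C) (f : nat -> R -> C).
Hypothesis Hf : forall x,
  series (fun j => vecpart x ^+ j * f j (scpart x)) @ \oo --> H x.

(* The profiles are power series in [vsq x = - vecpart x ^+ 2], whence the signs. *)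
Definition pe t A k : R := (-1) ^+ k * cl_coef (f k.*2 t) A.
Definition qo t A k : R := (-1) ^+ k * cl_coef (f k.*2.+1 t) A.

Let S t r := series (fun j => (r *: om) ^+ j * f j t).

Lemma S_cvg t r : S t r @ \oo --> H (pt t r).
Proof. by have := @Hf (pt t r); rewrite vecpart_pt scpart_pt. Qed.

Lemma om_double k r : (r *: om) ^+ k.*2 = ((- r ^+ 2) ^+ k)%:A.
Proof.
have E : (r *: om) * (r *: om) = (- r ^+ 2)%:A.
  by rewrite -scalerAl -scalerAr om2 scalerA scalerN scaleNr expr2.
elim: k => [|k IH]; first by rewrite !expr0 scale1r.
by rewrite doubleS exprS exprS IH mulrA E mulr_algl scalerA -exprS.
Qed.

(** Adding the series at [r] and [- r], where [r ^ 2 = s], keeps the even terms only, and these form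
    a power series in [s]. It converges for every [s > 0]. *)
Lemma pe_entire t A : entire (pe t A).
Proof.
apply: cvg_entire => s s0; pose r := Num.sqrt s.
have r2 : r ^+ 2 = s by rewrite sqr_sqrtr // ltW.
have h := cvgD (@S_cvg t r) (@S_cvg t (- r)).
have h1 : series (fun j => (1 + (-1) ^+ j) *: ((r *: om) ^+ j * f j t)) @ \oo -->
    H (pt t r) + H (pt t (- r)).
  rewrite (_ : series _ = fun N => S t r N + S t (- r) N); first exact: h.
  apply/funext => N; rewrite /S /series /= -big_split; apply: eq_bigr => j _ /=.
  by rewrite !exprZn [(- r) ^+ j]exprNn -!scalerAl scalerDl scale1r scalerA.
have h2 := cvg_series_even h1.
have /h2 h3 :
    forall k, (1 + (-1) ^+ k.*2.+1) *: ((r *: om) ^+ k.*2.+1 * f k.*2.+1 t) = 0.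
  by move=> k; rewrite -signr_odd /= odd_double /= expr1 subrr scale0r.
pose L (a : C) : R^o := cl_coef ((2 : R)^-1 *: a) A.
have Ll : linear L.
  by move=> k u w; rewrite /L !(cl_coefD, cl_coefZ) /GRing.scale /=; ring.
suff -> : pseries (pe t A) s =
    L \o series (fun k => (1 + (-1) ^+ k.*2) *: ((r *: om) ^+ k.*2 * f k.*2 t)).
  exact: cvgP (continuous_cvg _ (@cl_linear_continuous _ _ _ L Ll _) h3).
apply/funext => N.
rewrite /L /pseries /series /= scaler_sumr cl_coef_sum.
apply: eq_bigr => k _.
rewrite !cl_coefZ -signr_odd odd_double expr0 om_double mulr_algl cl_coefZ r2 /pe
  [(- s) ^+ k]exprNn.
by field.
Qed.

(** The difference at [r] and [- r] keeps the odd terms, each with a factor [2 * r * om]; left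
    multiplication by [om] and division by [- 2 * r] remove it, since [om ^ 2 = -1]. *)
Lemma qo_entire t A : entire (qo t A).
Proof.
apply: cvg_entire => s s0; pose r := Num.sqrt s.
have r2 : r ^+ 2 = s by rewrite sqr_sqrtr // ltW.
have r0 : r != 0 by rewrite gt_eqF // sqrtr_gt0.
have h := cvgB (@S_cvg t r) (@S_cvg t (- r)).
have h1 : series (fun j => (1 - (-1) ^+ j) *: ((r *: om) ^+ j * f j t)) @ \oo -->
    H (pt t r) - H (pt t (- r)).
  rewrite (_ : series _ = fun N => S t r N - S t (- r) N); first exact: h.
  apply/funext => N; rewrite /S /series /= -sumrB; apply: eq_bigr => j _ /=.
  by rewrite !exprZn [(- r) ^+ j]exprNn -!scalerAl scalerBl scale1r scalerA.
have /(cvg_series_odd h1) h3 : forall k, (1 - (-1) ^+ k.*2) *: ((r *: om) ^+ k.*2 * f k.*2 t) = 0.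
  by move=> k; rewrite -signr_odd odd_double expr0 subrr scale0r.
pose L (a : C) : R^o := cl_coef (- (2 * r)^-1 *: (om * a)) A.
have Ll : linear L.
  by move=> k u w; rewrite /L mulrDr -scalerAr !(cl_coefD, cl_coefZ) /GRing.scale /=; ring.
suff -> : pseries (qo t A) s =
    L \o series (fun k => (1 - (-1) ^+ k.*2.+1) *: ((r *: om) ^+ k.*2.+1 * f k.*2.+1 t)).
  exact: cvgP (continuous_cvg _ (@cl_linear_continuous _ _ _ L Ll _) h3).
apply/funext => N.
rewrite /L /pseries /series /= mulr_sumr scaler_sumr cl_coef_sum.
apply: eq_bigr => k _.
rewrite -signr_odd /= odd_double /= expr1 exprS om_double r2 mulr_algr /qo -!scalerAl.
rewrite -!scalerAr mulrA om2 mulN1r !cl_coefZ cl_coefN [(- s) ^+ k]exprNn.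
by rewrite /GRing.scale /=; field.
Qed.

Lemma sum_basis_coef (a : C) : \sum_A cl_coef a A *: cl_basis R A = a.
Proof. by rewrite -cl_basisE. Qed.

(** The dependence on the scalar part sits in the coefficients, not in [ta] and [si]. In vector
    directions these coefficients are constant and the calculus of [prof] applies. *)
Lemma series_split x :
  H x = \sum_A prof (fun=> 1) (fun=> 1) (pe (scpart x) A) (qo (scpart x) A) x * cl_basis R A.
Proof.
set t := scpart x.
have PE (d : {set 'I_n} -> nat -> R) (g : nat -> C) (w : C) : (forall A, entire (d A)) ->
    (forall A k, d A k = (-1) ^+ k * cl_coef (g k) A) ->
    series (fun k => (- vsq x) ^+ k *: (w * g k)) @ \oo -->
    \sum_A psum (d A) (vsq x) *: (w * cl_basis R A).
  move=> de dE; rewrite (_ : series _ =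
    fun N => \sum_A pseries (d A) (vsq x) N *: (w * cl_basis R A)).
    by apply: cvg_sum_scale => A; exact: psum_cvg.
  apply/funext => N; rewrite /pseries /series /=.
  under [RHS]eq_bigr do rewrite scaler_suml.
  rewrite exchange_big /=; apply: eq_bigr => k _.
  rewrite -{1}[g k]sum_basis_coef mulr_sumr scaler_sumr; apply: eq_bigr => A _.
  by rewrite -scalerAr scalerA dE [(- vsq x) ^+ k]exprNn; congr (_ *: _); ring.
have ce := PE (pe t) (fun k => f k.*2 t) 1 (pe_entire t) (fun _ _ => erefl).
have co := PE (qo t) (fun k => f k.*2.+1 t) (vecpart x) (qo_entire t) (fun _ _ => erefl).
have := cvg_series_interleave ce co.
rewrite (_ : interleave _ _ = fun j => vecpart x ^+ j * f j t) => [cs|]; last first.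
  apply/funext => j; rewrite /interleave -[in RHS](odd_double_half j).
  case: (odd j); rewrite ?add1n ?add0n ?exprS vecpart_double.
    by rewrite mulr_algr -scalerAl.
  by rewrite mulr_algl mul1r.
rewrite (cvg_unique _ (@Hf x) cs) // -big_split; apply: eq_bigr => A _ /=.
by rewrite /prof !mul1r mulrDl -!scalerAl mul1r.
Qed.

End Coefficients.

Lemma cl_coef_sum_basis (u : {set 'I_n} -> R) A :
  cl_coef (\sum_B u B *: cl_basis R B) A = u A.
Proof.
rewrite cl_coef_sum (bigD1 A) //= big1 ?addr0 => [|B BA].
  by rewrite cl_coefZ cl_coef_basis eqxx mulr1.
by rewrite cl_coefZ cl_coef_basis (negPf BA) mulr0.
Qed.

(** The shape of the values at [pt t r]: the components [u] and [w] are recovered from the parts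
    even and odd in [r]. *)
Definition onaxis (u w : {set 'I_n} -> R) (r : R) : C :=
  \sum_A (u A *: 1 + w A *: (r *: om)) * cl_basis R A.

Lemma onaxis_even u w r A :
  cl_coef ((2 : R)^-1 *: (onaxis u w r + onaxis u w (- r))) A = u A.
Proof.
rewrite -big_split scaler_sumr /= -[RHS]cl_coef_sum_basis; congr cl_coef.
apply: eq_bigr => B _; rewrite -mulrDl scaleNr scalerN addrACA subrr addr0.
by rewrite -scalerDl -scalerAl mul1r scalerA; congr (_ *: _); field.
Qed.

Lemma onaxis_odd u w r A : r != 0 ->
  cl_coef (- (2 * r)^-1 *: (om * (onaxis u w r - onaxis u w (- r)))) A = w A.
Proof.
move=> r0; rewrite -sumrB mulr_sumr scaler_sumr /= -[RHS]cl_coef_sum_basis; congr cl_coef.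
apply: eq_bigr => B _; rewrite -mulrBl [- r *: om]scaleNr scalerN opprD opprK addrACA subrr add0r.
rewrite -scalerDl scalerA mulrA -scalerAr om2 -!scalerAl mulN1r scalerN -scaleNr scalerA.
by congr (_ *: _); field.
Qed.

(** The vector derivatives of [H] can be computed from the series. Monogenicity then yields the
    derivative in [t], of which only existence and continuity are known, again as a series in [s].
    Its coordinates satisfy the hypotheses of [pseries_system_zero]. *)
Lemma is_gck_zero H : is_gck setT (fun=> 0) H -> forall x, H x = 0.
Proof.
move=> [[C1 M _] [f hf] H0].
have Hf x : series (fun j => vecpart x ^+ j * f j (scpart x)) @ \oo --> H x.
  exact: hf.
have ep := pe_entire Hf; have eq_ := qo_entire Hf.
pose P A t s := psum (pe f t A) s; pose P1 A t s := psum (pseries_diffs (pe f t A)) s.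
pose Q A t s := psum (qo f t A) s; pose Q1 A t s := psum (pseries_diffs (qo f t A)) s.
have HE t r : H (pt t r) = onaxis (P ^~ t ^~ (r ^+ 2)) (Q ^~ t ^~ (r ^+ 2)) r.
  rewrite (series_split Hf) scpart_pt /prof vecpart_pt vsq_pt /onaxis.
  by apply: eq_bigr => A _; rewrite !mul1r.
have dHi x i : partial (lift ord0 i) H x = \sum_A
    ((2 * x ord0 (lift ord0 i)) *: prof (fun=> 1) (fun=> 1)
        (pseries_diffs (pe f (scpart x) A)) (pseries_diffs (qo f (scpart x) A)) x
     + (1 * psum (qo f (scpart x) A) (vsq x)) *: cl_gen i) * cl_basis R A.
  apply: (@derive_val _ _ _ _ _ _ _ _).
  have d A := is_derive_cl_linear (@cl_mulr_linear R n (cl_basis R A))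
    (is_derive_profi (fun=> 1) (fun=> 1) x i (ep (scpart x) A) (eq_ (scpart x) A)).
  apply: eq_is_derive_line (is_derive_bigsum d) => h.
  rewrite (series_split Hf); suff -> : scpart (h *: ei R i + x) = scpart x by [].
  by rewrite /scpart !mxE mulr0 add0r.
(* The Cauchy-Riemann equation is solved for the one derivative that the series does not give. *)
have dH0 t r : partial ord0 H (pt t r) =
    onaxis (fun A => 2 * r ^+ 2 * Q1 A t (r ^+ 2) + n%:R * Q A t (r ^+ 2))
      (fun A => - 2 * P1 A t (r ^+ 2)) r.
  have /eqP := M (pt t r) I; rewrite /cauchy_riemann addr_eq0 => /eqP ->.
  under eq_bigr do rewrite dHi mulr_sumr.
  rewrite exchange_big -sumrN; apply: eq_bigr => A _ /=.
  under eq_bigr do rewrite mulrA.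
  rewrite -mulr_suml dirac_profi scpart_pt vecpart_pt vsq_pt -mulNr !mul1r; congr (_ * _).
  rewrite -/(P1 A t _) -/(Q1 A t _) -/(Q A t _).
  by apply: cl_ext => B; rewrite !(cl_coefD, cl_coefN, cl_coefZ); ring.
have dpt (t r : R) : is_derive t 1 (fun t => H (pt t r)) (partial ord0 H (pt t r)).
  have [/derivableP d _] := C1 ord0 (pt t r) I.
  apply/is_derive_line; move/is_derive_line: d.
  rewrite (_ : (fun h => H (pt _ _)) = fun h => H (h *: delta_mx ord0 ord0 + pt t r)) //.
  by apply/funext => h; rewrite pt_shift [h%:A]mulr1 addrC.
have cpt r : continuous (fun t => partial ord0 H (pt t r)).
  apply: (continuous_compose (@pt_continuous r)) => y.
  by have [] := C1 ord0 y I.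
have linE A : linear (fun a : C => cl_coef ((2 : R)^-1 *: a) A : R^o).
  by move=> k u w; rewrite !(cl_coefD, cl_coefZ) /GRing.scale /=; ring.
have linO r A : linear (fun a : C => cl_coef (- (2 * r)^-1 *: (om * a)) A : R^o).
  by move=> k u w; rewrite mulrDr -scalerAr !(cl_coefD, cl_coefZ) /GRing.scale /=; ring.
have zero A : forall t k, pe f t A k = 0 /\ qo f t A k = 0.
  have wE t s : psum (fun k => (2 * k%:R + n%:R) * qo f t A k) s =
      2 * s * Q1 A t s + n%:R * Q A t s by rewrite psum_affine.
  have wO t s : psum (fun k => - 2 * k.+1%:R * pe f t A k.+1) s = - 2 * P1 A t s.
    rewrite /P1 -psumZ; last exact: entire_diffs.
    by congr psum; apply/funext => k; rewrite /pseries_diffs mulrA.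
  have r2 (s : R) : 0 < s -> Num.sqrt s ^+ 2 = s by move=> s0; rewrite sqr_sqrtr // ltW.
  have r0 (s : R) : 0 < s -> Num.sqrt s != 0 by move=> s0; rewrite gt_eqF // sqrtr_gt0.
  (* With [r = sqrt s], the even part in [r] isolates the equation for [P_t] and the odd part the
     one for [Q_t]. *)
  have dE t (s : R) : 0 < s -> cl_coef ((2 : R)^-1 *: (partial ord0 H (pt t (Num.sqrt s))
        + partial ord0 H (pt t (- Num.sqrt s)))) A =
      psum (fun k => (2 * k%:R + n%:R) * qo f t A k) s.
    by move=> s0; rewrite !dH0 sqrrN onaxis_even wE r2.
  have dO t (s : R) : 0 < s -> cl_coef (- (2 * Num.sqrt s)^-1 *: (om *
        (partial ord0 H (pt t (Num.sqrt s)) - partial ord0 H (pt t (- Num.sqrt s))))) A =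
      psum (fun k => - 2 * k.+1%:R * pe f t A k.+1) s.
    by move=> s0; rewrite !dH0 sqrrN (onaxis_odd _ _ _ (r0 _ s0)) wO r2.
  apply: (@pseries_system_zero _ _ _ (fun k => 2 * k%:R + n%:R) (fun k => - 2 * k.+1%:R)).
  - move=> k; rewrite ger0_norm ?addr_ge0 ?mulr_ge0 //.
    by rewrite -natrM -natrD ler1n (leq_trans _ (leq_addl _ _)) // (leq_trans _ (ltn_ord i0)).
  - move=> k; rewrite normrM normrN !normr_nat -natrM ler1n //.
  - by move=> t; exact: entire_affine.
  - move=> t; have := entireZ (- 2) (entire_diffs (ep t A)).
    by congr entire; apply/funext => k; rewrite /pseries_diffs mulrA.
  - move=> s t s0.
    have d := is_derive_cl_linear (linE A) (is_deriveD (dpt t (Num.sqrt s)) (dpt t (- Num.sqrt s))).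
    apply: eq_is_derive_line (is_derive_eq d (dE t s s0)) => h.
    by rewrite !fctE !HE sqrrN onaxis_even r2.
  - move=> s t s0.
    have d := is_derive_cl_linear (linO (Num.sqrt s) A)
      (is_deriveB (dpt t (Num.sqrt s)) (dpt t (- Num.sqrt s))).
    apply: eq_is_derive_line (is_derive_eq d (dO t s s0)) => h.
    by rewrite !fctE !HE sqrrN (onaxis_odd _ _ _ (r0 _ s0)) r2.
  - move=> s s0; rewrite -(funext (fun t => dE t s s0)).
    exact: (continuous_compose (continuous_add (cpt _) (cpt _))
      (@cl_linear_continuous _ _ _ _ (linE A))).
  - move=> s s0; rewrite -(funext (fun t => dO t s s0)).
    exact: (continuous_compose (continuous_sub (cpt _) (cpt _))
      (@cl_linear_continuous _ _ _ _ (linO (Num.sqrt s) A))).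
  (* The point [pt t 0] is real, and the even part of [H] at [r = 0] is the leading coefficient. *)
  - move=> t; have := H0 t I.
    have -> : realpoint n t = pt t 0 by rewrite /pt scale0r addr0.
    have := onaxis_even (fun B => P B t (0 ^+ 2)) (fun B => Q B t (0 ^+ 2)) 0 A.
    rewrite oppr0 -HE => + h; rewrite h addr0 scaler0 cl_coef0 expr0n /P psum0 //.
move=> x; rewrite (series_split Hf) big1 // => A _.
rewrite /prof !psum_eq0 ?mulr0 ?scale0r ?addr0 ?mul0r // => k; first exact: (zero A _ k).2.
exact: (zero A _ k).1.
Qed.

End GckUniqueness.

(** * A Gronwall argument for a linear system *)

Section Gronwall.
Variable R : realType.

(** The function [N l * expR (- K * l)] starts at 0 and has nonpositive derivative, so
    [N 1 <= 0]. *)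
Lemma gronwall_zero (N dN : R -> R) (K : R) :
  (forall l : R, is_derive l 1 N (dN l)) -> (forall l, dN l <= K * N l) ->
  (forall l, 0 <= N l) -> N 0 = 0 -> N 1 = 0.
Proof.
move=> dN1 dNK N0 N00; apply/eqP; rewrite eq_le N0 andbT.
pose g l := N l * expR (- K * l); pose dg l := (dN l - K * N l) * expR (- K * l).
have dg1 (l : R) : is_derive l 1 g (dg l).
  have d2 : is_derive l 1 (fun l => - K * l) (- K).
    by have := is_deriveZ (- K) (is_derive_id l (1 : R)); rewrite /GRing.scale /= mulr1.
  have := is_derive_mul (dN1 l) (is_derive_chain (is_derive_expR _) d2).
  by rewrite (_ : _ + _ = dg l) // /dg; ring.
have gc : {within `[0 : R, 1], continuous g}.
  by apply: derivable_within_continuous => l _; have [] := dg1 l.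
have [x _ gx] := MVT ltr01 (fun l _ => dg1 l) gc.
have g1 : g 1 <= 0.
  have -> : g 1 = dg x by move: gx; rewrite {2}/g N00 mul0r !subr0 mulr1.
  by rewrite /dg mulr_le0_ge0 ?expR_ge0 // subr_le0.
by move: g1; rewrite /g pmulr_lle0 // expR_gt0.
Qed.

Lemma linear4_zero (D1 D2 D3 D4 : R -> R) (e t s : R) : `|e| <= 1 ->
  (forall l : R, is_derive l 1 D1 (- e * (t * D3 l - s * D4 l))) ->
  (forall l : R, is_derive l 1 D2 (- e * (D3 l + t * D4 l))) ->
  (forall l : R, is_derive l 1 D3 (t * D1 l - s * D2 l)) ->
  (forall l : R, is_derive l 1 D4 (D1 l + t * D2 l)) ->
  D1 0 = 0 -> D2 0 = 0 -> D3 0 = 0 -> D4 0 = 0 ->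
  [/\ D1 1 = 0, D2 1 = 0, D3 1 = 0 & D4 1 = 0].
Proof.
move=> e1 d1 d2 d3 d4 z1 z2 z3 z4.
pose k := 1 + `|t| + `|s|.
have k0 : 0 <= k by rewrite /k !addr_ge0.
pose N l := D1 l * D1 l + D2 l * D2 l + (D3 l * D3 l + D4 l * D4 l).
have sq0 (a : R) : 0 <= a * a by rewrite -expr2 sqr_ge0.
have amgm (c a b : R) : `|c| <= k -> 2 * (c * (a * b)) <= k * (a * a + b * b).
  rewrite ler_norml => /andP[ck kc]; have := sq0 (a - b); have := sq0 (a + b).
  nra.
have tk : `|t| <= k by rewrite /k; have := normr_ge0 s; lra.
have sk : `|s| <= k by rewrite /k; have := normr_ge0 t; lra.
have k1 : `|1| <= k by rewrite normr1 /k; have := normr_ge0 t; have := normr_ge0 s; lra.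
have ek (c : R) : `|c| <= k -> `|- e * c| <= k.
  by move=> ck; rewrite normrM normrN -[k]mul1r ler_pM.
have NN (c : R) : `|c| <= k -> `|- c| <= k by rewrite normrN.
have N1 : N 1 = 0.
  apply: (@gronwall_zero N (fun l => _) (4 * k)) => [l|l|l|].
  - exact: is_deriveD (is_deriveD (is_derive_mul (d1 l) (d1 l)) (is_derive_mul (d2 l) (d2 l)))
      (is_deriveD (is_derive_mul (d3 l) (d3 l)) (is_derive_mul (d4 l) (d4 l))).
  (* The derivative of [N] is a sum of eight products [2 c a b], each at most [k * (a ^ 2 + b ^ 2)];
     every [D_i] occurs in four of them, whence [4 * k]. *)
  - have := amgm _ (D1 l) (D3 l) (ek _ tk); have := amgm _ (D1 l) (D4 l) (ek _ (NN _ sk)).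
    have := amgm _ (D2 l) (D3 l) (ek _ k1); have := amgm _ (D2 l) (D4 l) (ek _ tk).
    have := amgm _ (D3 l) (D1 l) tk; have := amgm _ (D3 l) (D2 l) (NN _ sk).
    have := amgm _ (D4 l) (D1 l) k1; have := amgm _ (D4 l) (D2 l) tk.
    rewrite /N; lra.
  - by rewrite /N !addr_ge0.
  - by rewrite /N z1 z2 z3 z4 mulr0 !addr0.
move: N1; rewrite /N => E.
have h1 := sq0 (D1 1); have h2 := sq0 (D2 1).
have h3 := sq0 (D3 1); have h4 := sq0 (D4 1).
have Z (a : R) : a * a = 0 -> a = 0 by move=> /eqP; rewrite mulf_eq0 orbb => /eqP.
by split; apply: Z; lra.
Qed.

End Gronwall.

(** * The addition theorem for paravectors *)

Section AdditionTheorem.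
Variables (R : realType) (n : nat).
Local Notation C := (clifford R n).
Local Notation E := 'rV[R]_n.+1.
Variables (e : R) (ta si : R -> R).
Hypothesis e2 : e * e = 1.
Hypothesis dta : forall t : R, is_derive t 1 ta (- e * si t).
Hypothesis dsi : forall t : R, is_derive t 1 si (ta t).
Hypothesis ta0 : ta 0 = 1.
Hypothesis si0 : si 0 = 0.

Lemma norm_eps : `|e| = 1.
Proof.
apply/eqP; rewrite -(@eqrXn2 _ 2) // expr1n -normrX expr2 e2 normr1 //.
Qed.

(** As [xv ^ 2 = - s], these are the coefficients in [s] of the cosine-type series at [xv], and
    those of [scoef] belong to the sine-type series divided by [xv]. *)
Definition ccoef k : R := e ^+ k / k.*2`!%:R.
Definition scoef k : R := e ^+ k / k.*2.+1`!%:R.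

Lemma inv_fact_entire (m : nat -> nat) : (forall k, (k <= m k)%N) ->
  entire (fun k => e ^+ k / (m k)`!%:R).
Proof.
move=> km; apply: entire_le (entire_inv_fact (1 : R)) => k.
rewrite !normrM !normrX norm_eps normr1 !expr1n !mul1r !normfV !normr_nat.
by rewrite lef_pV2 ?posrE ?ltr0n ?fact_gt0 // ler_nat leq_fact.
Qed.

Lemma ccoef_entire : entire ccoef.
Proof. by apply: inv_fact_entire => k; rewrite -addnn leq_addr. Qed.

Lemma scoef_entire : entire scoef.
Proof. by apply: inv_fact_entire => k; rewrite -addnn -addnS leq_addr. Qed.

Lemma diffs_ccoef k : pseries_diffs ccoef k = e / 2 * scoef k.
Proof.
rewrite /pseries_diffs /ccoef /scoef exprS doubleS factS natrM.
have f0 : k.*2.+1`!%:R != 0 :> R by rewrite pnatr_eq0 -lt0n fact_gt0.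
have -> : k.*2.+2%:R = 2 * k.+1%:R :> R by rewrite -natrM mul2n -doubleS.
by field; rewrite f0 nat1r pnatr_eq0.
Qed.

Lemma affine_scoef k : (2 * k%:R + 1) * scoef k = ccoef k.
Proof.
rewrite /ccoef /scoef factS natrM.
have f0 : k.*2`!%:R != 0 :> R by rewrite pnatr_eq0 -lt0n fact_gt0.
have -> : k.*2.+1%:R = 2 * k%:R + 1 :> R by rewrite -natrM mul2n natr1.
by field; rewrite f0 -natrM natr1 pnatr_eq0.
Qed.

Section Powers.
Variable x : E.
Let t := scpart x.
Let s := vsq x.

Fixpoint UV k : R * R :=
  if k is j.+1 then (t * (UV j).1 - s * (UV j).2, (UV j).1 + t * (UV j).2) else (1, 0).

Lemma paravector_exp k : paravector x ^+ k = (UV k).1%:A + (UV k).2 *: vecpart x.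
Proof.
elim: k => [|k IH]; first by rewrite expr0 scale0r addr0 scale1r.
rewrite exprS IH /paravector -/t mulrDl !mulrDr !mulr_algl !mulr_algr /=.
rewrite -scalerAr vecpart_sqr -/s.
by apply: cl_ext => A; rewrite !(cl_coefD, cl_coefN, cl_coefZ); ring.
Qed.

Let K : R := 1 + `|t| + `|s|.

Lemma UV_bound k : `|(UV k).1| <= K ^+ k /\ `|(UV k).2| <= K ^+ k.
Proof.
have K0 : 0 <= K by rewrite !addr_ge0.
elim: k => [|k [IH1 IH2]]; first by rewrite /= normr1 normr0.
rewrite /= exprS; have KK := exprn_ge0 k K0.
have a1 := ler_wpM2l (normr_ge0 t) IH1; have a2 := ler_wpM2l (normr_ge0 t) IH2.
have a3 := ler_wpM2l (normr_ge0 s) IH2.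
split; apply: le_trans (ler_normD _ _) _; rewrite ?normrN ?normrM /K.
  by move: a1 a2 a3 KK; rewrite /K; lra.
have a4 : 0 <= `|s| * K ^+ k by rewrite mulr_ge0.
by move: a1 a2 a3 a4 KK IH1; rewrite /K; lra.
Qed.

(** The derivatives of order [k] at 0 of [ta], and for [eS] of [si]. *)
Definition eC k : R := if odd k then 0 else (- e) ^+ k./2.
Definition eS k : R := if odd k then (- e) ^+ k./2 else 0.

Lemma eC_S k : eC k.+1 = - e * eS k.
Proof.
rewrite /eC /eS /=; case: (boolP (odd k)) => ok /=; last by rewrite mulr0.
by rewrite uphalf_half ok add1n exprS.
Qed.

Lemma eS_S k : eS k.+1 = eC k.
Proof.
rewrite /eC /eS /=; case: (boolP (odd k)) => ok //=.
by rewrite uphalf_half (negPf ok).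
Qed.

Lemma eC_le1 k : `|eC k| <= 1.
Proof. by rewrite /eC; case: ifP; rewrite ?normr0 // normrX normrN norm_eps expr1n. Qed.

Lemma eS_le1 k : `|eS k| <= 1.
Proof. by rewrite /eS; case: ifP; rewrite ?normr0 // normrX normrN norm_eps expr1n. Qed.

Lemma power_entire (a b : nat -> R) : (forall k, `|a k| <= 1) ->
  (forall k, `|b k| <= K ^+ k) -> entire (fun k => a k * b k / k`!%:R).
Proof.
move=> a1 bK; apply: entire_le (entire_inv_fact K) => k.
rewrite !normrM ler_wpM2r // [leRHS]ger0_norm ?exprn_ge0 ?addr_ge0 //.
by rewrite -[leRHS]mul1r ler_pM.
Qed.

Lemma is_derive_power (a da b db : nat -> R) (l : R) : (forall k, `|a k| <= 1) ->
  (forall k, `|b k| <= K ^+ k) -> (forall k, a k.+1 = da k) -> (forall k, b k.+1 = db k) ->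
  is_derive l 1 (psum (fun k => a k * b k / k`!%:R)) (psum (fun k => da k * db k / k`!%:R) l).
Proof.
move=> a1 bK ada bdb; have := is_derive_psum l (power_entire a1 bK).
congr (is_derive _ _ _ (psum _ _)); apply/funext => k.
rewrite /pseries_diffs -ada -bdb factS natrM.
have f0 : k`!%:R != 0 :> R by rewrite pnatr_eq0 -lt0n fact_gt0.
by field; rewrite f0 nat1r pnatr_eq0.
Qed.

Let U k := (UV k).1.
Let V k := (UV k).2.
(** As functions of [l], [X] and [Y] are the two components of the cosine-type series at [l * x],
    and [X2], [Y2] those of the sine-type series. Only [l = 1] is wanted; the parameter supplies a
    differential equation. *)
Let X := psum (fun k => eC k * U k / k`!%:R).
Let Y := psum (fun k => eC k * V k / k`!%:R).
Let X2 := psum (fun k => eS k * U k / k`!%:R).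
Let Y2 := psum (fun k => eS k * V k / k`!%:R).

Let UK k : `|U k| <= K ^+ k. Proof. exact: (UV_bound k).1. Qed.
Let VK k : `|V k| <= K ^+ k. Proof. exact: (UV_bound k).2. Qed.

(** With [x] replaced by [l * x], both sides solve the same linear system in [l] with the same
    initial values; their difference vanishes by [linear4_zero]. *)
Lemma power_sums :
  [/\ X 1 = ta t * psum ccoef s, Y 1 = - e * (si t * psum scoef s),
      X2 1 = si t * psum ccoef s & Y2 1 = ta t * psum scoef s].
Proof.
have eCU := power_entire eC_le1 UK; have eCV := power_entire eC_le1 VK.
have eSU := power_entire eS_le1 UK; have eSV := power_entire eS_le1 VK.
have comb (p q : R) (a b c : nat -> R) l : entire b -> entire c ->
    (forall k, a k = p * b k + q * c k) -> psum a l = p * psum b l + q * psum c l.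
  move=> eb ec abc; rewrite -!psumZ // -psumD; try exact: entireZ.
  by congr psum; apply/funext.
have dX (l : R) : is_derive l 1 X (- e * (t * X2 l - s * Y2 l)).
  have := is_derive_power l eC_le1 UK eC_S (fun _ => erefl).
  rewrite (comb (- e * t) (e * s) _ _ _ l eSU eSV) => [|k].
    by rewrite (_ : _ + _ = - e * (t * X2 l - s * Y2 l)) //; rewrite /X2 /Y2; ring.
  by rewrite /U /V /=; ring.
have dY (l : R) : is_derive l 1 Y (- e * (X2 l + t * Y2 l)).
  have := is_derive_power l eC_le1 VK eC_S (fun _ => erefl).
  rewrite (comb (- e) (- e * t) _ _ _ l eSU eSV) => [|k].
    by rewrite (_ : _ + _ = - e * (X2 l + t * Y2 l)) //; rewrite /X2 /Y2; ring.
  by rewrite /U /V /=; ring.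
have dX2 (l : R) : is_derive l 1 X2 (t * X l - s * Y l).
  have := is_derive_power l eS_le1 UK eS_S (fun _ => erefl).
  rewrite (comb t (- s) _ _ _ l eCU eCV) => [|k].
    by rewrite mulNr.
  by rewrite /U /V /=; ring.
have dY2 (l : R) : is_derive l 1 Y2 (X l + t * Y l).
  have := is_derive_power l eS_le1 VK eS_S (fun _ => erefl).
  rewrite (comb 1 t _ _ _ l eCU eCV) => [|k].
    by rewrite mul1r.
  by rewrite /U /V /=; ring.
pose ka l := psum ccoef (l * l * s); pose rh l := l * psum scoef (l * l * s).
have dls (l : R) : is_derive l 1 (fun l => l * l * s) (2 * l * s).
  have := is_derive_mul (is_derive_mul (is_derive_id l 1) (is_derive_id l 1)) (is_derive_cst s l 1).
  by rewrite (_ : _ + _ = 2 * l * s) // /cst; ring.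
have dps (b : nat -> R) (l : R) : entire b -> is_derive l 1 (fun l => psum b (l * l * s))
    (psum (pseries_diffs b) (l * l * s) * (2 * l * s)).
  move=> eb; have := @is_derive_chain _ _ (psum b) (fun l : R => l * l * s) l 1 _ _
    (is_derive_psum _ eb) (dls l).
  exact.
have dka (l : R) : is_derive l 1 ka (e * s * rh l).
  have := dps ccoef l ccoef_entire.
  rewrite (_ : psum (pseries_diffs ccoef) (l * l * s) * _ = e * s * rh l) //.
  rewrite (funext diffs_ccoef) psumZ; last exact: scoef_entire.
  by rewrite /rh; field.
have drh (l : R) : is_derive l 1 rh (ka l).
  have := is_derive_mul (is_derive_id l 1) (dps scoef l scoef_entire).
  rewrite (_ : _ + _ = ka l) // /ka -(funext affine_scoef) psum_affine; last exact: scoef_entire.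
  by ring.
have dtl (l : R) : is_derive l 1 (fun l => l * t) t.
  have := is_derive_mul (is_derive_id l 1) (is_derive_cst t l 1).
  by rewrite mul1r mulr0 addr0.
have dT (l : R) : is_derive l 1 (fun l => ta (l * t)) (- e * si (l * t) * t).
  have := @is_derive_chain _ _ ta (fun l : R => l * t) l 1 _ _ (dta _) (dtl l).
  exact.
have dS (l : R) : is_derive l 1 (fun l => si (l * t)) (ta (l * t) * t).
  have := @is_derive_chain _ _ si (fun l : R => l * t) l 1 _ _ (dsi _) (dtl l).
  exact.
have X0 : X 0 = 1 by rewrite /X psum0 // /eC /= expr0 fact0 /U /= !mulr1 divr1.
have Y0 : Y 0 = 0 by rewrite /Y psum0 // /V /= mulr0 mul0r.
have X20 : X2 0 = 0 by rewrite /X2 psum0 // /eS /= !mul0r.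
have Y20 : Y2 0 = 0 by rewrite /Y2 psum0 // /eS /= !mul0r.
have ka0 : ka 0 = 1.
  by rewrite /ka !mul0r psum0; [rewrite /ccoef expr0 double0 fact0 divr1 | exact: ccoef_entire].
have rh0 : rh 0 = 0 by rewrite /rh mul0r.
have [|||||||||E1 E2 E3 E4] := @linear4_zero R (fun l => X l - ta (l * t) * ka l)
  (fun l => Y l - - e * (si (l * t) * rh l)) (fun l => X2 l - si (l * t) * ka l)
  (fun l => Y2 l - ta (l * t) * rh l) e t s.
- by rewrite norm_eps.
- move=> l; have := is_deriveB (dX l) (is_derive_mul (dT l) (dka l)).
  rewrite [X in is_derive _ _ _ X -> _](_ : _ = - e * (t * (X2 l - si (l * t) * ka l) -
     s * (Y2 l - ta (l * t) * rh l))) //; ring.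
- move=> l; have := is_deriveB (dY l) (is_deriveZ (- e) (is_derive_mul (dS l) (drh l))).
  rewrite [X in is_derive _ _ _ X -> _](_ : _ = - e * ((X2 l - si (l * t) * ka l) +
     t * (Y2 l - ta (l * t) * rh l))) //; rewrite /GRing.scale /=; ring.
- move=> l; have := is_deriveB (dX2 l) (is_derive_mul (dS l) (dka l)).
  rewrite [X in is_derive _ _ _ X -> _](_ : _ = t * (X l - ta (l * t) * ka l) -
     s * (Y l - - e * (si (l * t) * rh l))) //; ring.
- move=> l; have := is_deriveB (dY2 l) (is_derive_mul (dT l) (drh l)).
  rewrite [X in is_derive _ _ _ X -> _](_ : _ = (X l - ta (l * t) * ka l) +
     t * (Y l - - e * (si (l * t) * rh l))) //; ring.
- by rewrite X0 ka0 mul0r ta0 mulr1 subrr.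
- by rewrite Y0 rh0 !mulr0 subrr.
- by rewrite X20 mul0r si0 mul0r subrr.
- by rewrite Y20 rh0 mulr0 subrr.
move: E1 E2 E3 E4; rewrite /ka /rh !mul1r => /eqP + /eqP + /eqP + /eqP; rewrite !subr_eq0.
by move=> /eqP -> /eqP -> /eqP -> /eqP ->.
Qed.

Lemma cvg_power_series (a : nat -> R) : (forall k, `|a k| <= 1) ->
  series (fun k => (a k / k`!%:R) *: paravector x ^+ k) @ \oo -->
  (psum (fun k => a k * U k / k`!%:R) 1)%:A +
  psum (fun k => a k * V k / k`!%:R) 1 *: vecpart x.
Proof.
move=> a1; have eU := power_entire a1 UK; have eV := power_entire a1 VK.
rewrite (_ : series _ = fun N => (pseries (fun k => a k * U k / k`!%:R) 1 N)%:A +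
  pseries (fun k => a k * V k / k`!%:R) 1 N *: vecpart x).
  by apply: cvgD; apply: cvgZr_tmp; exact: psum_cvg.
apply/funext => N; rewrite /pseries /series /= !scaler_suml -big_split.
apply: eq_bigr => k _ /=; rewrite paravector_exp scalerDr !scalerA !expr1n !mulr1.
by rewrite ![a k / _ * _]mulrAC.
Qed.

(** This is [ta (t + xv) = ta t * ta xv - e * (si t * si xv)], written as a separated function. *)
Lemma cvg_cos_series :
  series (fun k => ((- e) ^+ k / k.*2`!%:R) *: paravector x ^+ k.*2) @ \oo -->
  prof ta si ccoef (fun k => - e * scoef k) x.
Proof.
have [EX EY _ _] := power_sums.
have := cvg_power_series eC_le1; rewrite -/(X 1) -/(Y 1) EX EY => /cvg_series_even.
rewrite /prof -/s -/t psumZ; last exact: scoef_entire.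
rewrite mulrCA (_ : (fun k => _) = fun k => ((- e) ^+ k / k.*2`!%:R) *: paravector x ^+ k.*2).
  by apply=> k; rewrite /eC /= odd_double /= mul0r scale0r.
by apply/funext => k; rewrite /eC odd_double doubleK.
Qed.

Lemma cvg_sin_series :
  series (fun k => ((- e) ^+ k / k.*2.+1`!%:R) *: paravector x ^+ k.*2.+1) @ \oo -->
  prof si (fun t => - e * ta t) ccoef (fun k => - e * scoef k) x.
Proof.
have [_ _ EX EY] := power_sums.
have := cvg_power_series eS_le1; rewrite -/(X2 1) -/(Y2 1) EX EY => /cvg_series_odd.
rewrite /prof -/s -/t psumZ; last exact: scoef_entire.
(* The product [ta t * scoef] is written as [(- e * ta t) * (- e * scoef)], using [e * e = 1]; the
   sine thus gets the same coefficient sequences as the cosine. *)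
rewrite [- e * ta t * _]mulrACA mulrNN e2 mul1r.
rewrite (_ : (fun k => _) = fun k => ((- e) ^+ k / k.*2.+1`!%:R) *: paravector x ^+ k.*2.+1).
  by apply=> k; rewrite /eS odd_double mul0r scale0r.
by apply/funext => k; rewrite /eS /= odd_double /= uphalf_double.
Qed.

End Powers.
End AdditionTheorem.

(** * Iterated Laplacians on the coefficients *)

Section IteratedLaplacian.
Variables (R : realType) (n : nat).
Local Notation C := (clifford R n).
Local Notation E := 'rV[R]_n.+1.

Definition lap_coef (ka al : R) (c : nat -> R) k : R :=
  ka * c k + (4 * k%:R + al) * pseries_diffs c k.

Lemma lap_coef_entire ka al c : entire c -> entire (lap_coef ka al c).
Proof.
move=> ec; have := entireD (entireZ ka ec) (entireZ 2 (entire_affine (al / 2) (entire_diffs ec))).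
by congr entire; apply/funext => k; rewrite /lap_coef; field.
Qed.

Lemma iter_lap_entire ka al c j : entire c -> entire (iter j (lap_coef ka al) c).
Proof. by move=> ec; elim: j => [//|j IH]; exact: lap_coef_entire. Qed.

(** Only the scalar coefficients are tracked, as [vecpart] vanishes on the real axis, where the
    result will be evaluated. *)
Lemma iter_laplacian_prof (ta dta si dsi : R -> R) (ka : R) c q m :
  (forall t : R, is_derive t 1 ta (dta t)) -> (forall t : R, is_derive t 1 dta (ka * ta t)) ->
  (forall t : R, is_derive t 1 si (dsi t)) -> (forall t : R, is_derive t 1 dsi (ka * si t)) ->
  entire c -> entire q ->
  exists2 q', entire q' &
    iter m (@laplacian R n) (prof ta si c q) =
    prof ta si (iter m (lap_coef ka (2 * n%:R)) c) q'.
Proof.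
move=> dta1 dta2 dsi1 dsi2 ec eq_.
elim: m => [|m [q' eq' IH]]; first by exists q.
exists (lap_coef ka (2 * n%:R + 4) q'); first exact: lap_coef_entire.
rewrite iterS IH (laplacian_prof n dta1 dta2 dsi1 dsi2) //; last exact: iter_lap_entire.
by congr prof; apply/funext => k; rewrite /lap_coef !addrA.
Qed.

(** With [n = 2 m + 1] the two terms of [lap_coef] combine into [2 e (m - i) / (2 k + 2 i + 1)]
    times the previous coefficient. The factors [m - i] build the falling factorial; [i = m] and
    [k = 0] give the constant of the theorem up to sign. *)
Lemma iter_lap_ccoef (e : R) m i k : n = m.*2.+1 -> (i <= m)%N ->
  iter i (lap_coef (- e) (2 * n%:R)) (ccoef e) k =
  e ^+ (k + i) * (4 ^+ i * (m ^_ i)%:R * (k + i)`!%:R / (k`!%:R * (k + i).*2`!%:R)).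
Proof.
move=> nm; elim: i k => [|i IH] k im.
  rewrite /= ffactn0 addn0 /ccoef expr0; congr (_ * _).
  have f1 : k`!%:R != 0 :> R by rewrite pnatr_eq0 -lt0n fact_gt0.
  have f2 : k.*2`!%:R != 0 :> R by rewrite pnatr_eq0 -lt0n fact_gt0.
  by field; rewrite f1 f2.
rewrite iterS {1}/lap_coef /pseries_diffs !IH ?(ltnW im) // ffactnSr natrM natrB ?(ltnW im) //.
rewrite addSn addnS doubleS !exprS.
rewrite (factS k) (factS (k + i)) (factS (k + i).*2.+1) (factS (k + i).*2) !natrM.
have -> : (k + i).*2.+2%:R = 2 * (k%:R + i%:R + 1) :> R.
  by rewrite -natrD natr1 -natrM mul2n -doubleS.
have -> : (k + i).*2.+1%:R = 2 * (k%:R + i%:R) + 1 :> R.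
  by rewrite -natrD -natrM natr1 mul2n.
have -> : (k + i).+1%:R = k%:R + i%:R + 1 :> R by rewrite -natrD natr1.
have -> : n%:R = 2 * m%:R + 1 :> R by rewrite nm -natrM natr1 mul2n.
have -> : k.+1%:R = k%:R + 1 :> R by rewrite natr1.
have f1 : k`!%:R != 0 :> R by rewrite pnatr_eq0 -lt0n fact_gt0.
have f2 : (k + i).*2`!%:R != 0 :> R by rewrite pnatr_eq0 -lt0n fact_gt0.
have g1 : k%:R + 1 != 0 :> R by rewrite natr1 pnatr_eq0.
have g2 : k%:R + i%:R + 1 != 0 :> R by rewrite -natrD natr1 pnatr_eq0.
have g3 : 2 * (k%:R + i%:R) + 1 != 0 :> R by rewrite -natrD -natrM natr1 pnatr_eq0.
by field; rewrite f1 f2 g1 g2 g3.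
Qed.

End IteratedLaplacian.

(** * The Gamma function at positive integers *)

Section GammaFunction.
Variable R : realType.

(** The integral of [u ^ m * exp (- u)] over [u >= t], in closed form; the recursion is integration
    by parts. *)
Fixpoint gamma_tail m (t : R) : R :=
  if m is k.+1 then t ^+ k.+1 * expR (- t) + k.+1%:R * gamma_tail k t else expR (- t).

Lemma is_derive_expRN (t : R) : is_derive t 1 (fun t : R => expR (- t)) (- expR (- t)).
Proof.
have d : is_derive t (1 : R) (fun t : R => - t) (- 1) by exact: is_deriveN (is_derive_id t 1).
have := @is_derive_chain _ _ (@expR R) (fun t : R => - t) t 1 _ _ (is_derive_expR _) d.
by rewrite mulrN1.
Qed.

Lemma is_derive_gamma_tail m (t : R) :
  is_derive t 1 (gamma_tail m) (- (t ^+ m * expR (- t))).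
Proof.
elim: m => [|m IH]; first by rewrite expr0 mul1r; exact: is_derive_expRN.
have dX : is_derive t 1 (fun t : R => t ^+ m.+1) (m.+1%:R * t ^+ m).
  have := is_deriveX m.+1 (is_derive_id t (1 : R)).
  by rewrite /GRing.scale /= mulr1; apply: eq_is_derive_line => h; rewrite exprfctE.
have := is_deriveD (is_derive_mul dX (is_derive_expRN t)) (is_deriveZ m.+1%:R IH).
rewrite [X in is_derive _ _ _ X -> _](_ : _ = - (t ^+ m.+1 * expR (- t))) //.
by rewrite /GRing.scale /=; ring.
Qed.

(** From [t ^ (m + 2) / (m + 2)! <= exp t] the product is at most [(m + 2)! / t]. *)
Lemma expXN_cvg0 m : t ^+ m.+1 * expR (- t) @[t --> +oo%R] --> (0 : R).
Proof.
apply/cvgrPdist_le => e e0; near=> t.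
have t0 : 0 < t by near: t; apply: nbhs_pinfty_gt; rewrite num_real.
have te : m.+2`!%:R / e <= t by near: t; apply: nbhs_pinfty_ge; rewrite num_real.
have h := @expR_ge1Dxn _ t m.+1 (ltW t0).
have f0 : 0 < m.+2`!%:R :> R by rewrite ltr0n fact_gt0.
rewrite sub0r normrN ger0_norm ?mulr_ge0 ?exprn_ge0 ?expR_ge0 ?(ltW t0) //.
rewrite expRN ler_pdivrMr ?expR_gt0 //.
apply: (@le_trans _ _ (e * (t ^+ m.+2 / m.+2`!%:R))); last first.
  by rewrite ler_wpM2l ?(ltW e0) // (le_trans _ h) // lerDr.
rewrite (_ : e * _ = t ^+ m.+1 * (e * t / m.+2`!%:R)); last first.
  by rewrite exprSr; field; rewrite gt_eqF.
rewrite ler_peMr ?exprn_ge0 ?(ltW t0) // ler_pdivlMr // mul1r mulrC.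
by rewrite -ler_pdivrMr.
Unshelve. all: by end_near. Qed.

Lemma gamma_tail_cvg m : gamma_tail m t @[t --> +oo%R] --> (0 : R).
Proof.
elim: m => [|m IH]; first exact: cvgr_expR.
rewrite -[X in _ --> X]addr0 -[X in _ --> _ + X](mulr0 m.+1%:R).
by apply: cvgD; [exact: expXN_cvg0 | exact: cvgMr].
Qed.

Lemma gamma_tail0 m : gamma_tail m 0 = m`!%:R.
Proof.
elim: m => [|m IH]; first by rewrite /= oppr0 expR0.
by rewrite /= IH expr0n mul0r add0r factS natrM.
Qed.

(** Integer arguments suffice, because [(n + 1) / 2 = m + 1] for [n = 2 m + 1]. The primitive of the
    integrand is [- gamma_tail m]. *)
Lemma GammaS m : Gamma (m.+1%:R : R) = m`!%:R.
Proof.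
have gc : continuous (gamma_tail m) by exact: is_derive_continuous (is_derive_gamma_tail m).
have fc : continuous (fun t : R => t ^+ m * expR (- t)).
  apply: continuous_mul; first exact: exprn_continuous.
  by apply: is_derive_continuous => t; exact: is_derive_expRN.
have E : \int[lebesgue_measure]_(t in `[0 : R, +oo[) (t ^+ m * expR (- t)) = m`!%:R.
  rewrite (@Rintegral_ge0_continuous_FTC2y R (fun t => t ^+ m * expR (- t))
    (fun t => - gamma_tail m t) 0 0) ?gamma_tail0 ?opprK ?add0r //.
  - by move=> t t0; rewrite mulr_ge0 ?exprn_ge0 ?expR_ge0.
  - exact: continuous_subspaceT.
  - by rewrite -oppr0; apply: cvgN; exact: gamma_tail_cvg.
  - by move=> t _; have [] := is_deriveN (is_derive_gamma_tail m t).
  - by rewrite -(gamma_tail0 m); apply: cvg_at_right_filter; apply: cvgN; exact: gc.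
  - move=> t _; rewrite derive1E.
    have := @derive_val _ _ _ _ _ _ _ (is_deriveN (is_derive_gamma_tail m t)).
    by rewrite opprK.
rewrite -E /Gamma.
have -> : \int[lebesgue_measure]_(t in `]0 : R, +oo[) (t `^ (m.+1%:R - 1) * expR (- t)) =
    \int[lebesgue_measure]_(t in `]0 : R, +oo[) (t ^+ m * expR (- t)).
  apply: eq_Rintegral => t; rewrite inE /= in_itv /= andbT => t0.
  by rewrite -natr1 addrK powR_mulrn // ltW.
rewrite /Rintegral integral_itv_obnd_cbnd //.
apply/measurable_realfun.measurable_EFinP; apply: measurable_funTS.
exact: measurable_realfun.continuous_measurable_fun.
Qed.
Lemma gamma_constE m : gamma_const R m.*2.+1 =
  (-1) ^+ m * (4 ^+ m * m`!%:R * m`!%:R / m.*2`!%:R).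
Proof.
rewrite /gamma_const /= doubleK (_ : _ / 2 = m.+1%:R); last first.
  rewrite (_ : m.*2.+2 = 2 * m.+1)%N; last by rewrite mul2n.
  by rewrite natrM mulrC mulKf // pnatr_eq0.
rewrite GammaS -muln2 mulnC exprM -natrX expr2.
by rewrite -!mulrA; congr (_ * (_ * _)); rewrite mulrC -!mulrA.
Qed.

End GammaFunction.

(** * Existence of extensions and the Pythagorean identity *)

Section GckProducts.
Variables (R : realType) (n : nat) (i0 : 'I_n).
Local Notation C := (clifford R n).
Local Notation E := 'rV[R]_n.+1.

(** [gck] is defined by choice: the existence of [F] makes the chosen function an extension, and
    uniqueness identifies it with [F]. *)
Lemma gck_eq (f : R -> C) (F : E -> C) x : is_gck setT f F -> gck setT f x = F x.
Proof.
move=> fF; have gF : is_gck setT f (gck setT f) by rewrite /gck; case: xgetP => // /(_ F).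
have := is_gck_lin 1 (-1) gF fF.
rewrite (_ : (fun t => 1 *: f t + -1 *: f t) = fun=> 0); last first.
  by apply/funext => t; rewrite scale1r scaleN1r subrr.
move=> /(is_gck_zero i0)/(_ x)/eqP.
by rewrite scale1r scaleN1r subr_eq0 => /eqP.
Qed.

Lemma is_gck_one : is_gck setT (fun=> 1) (fun _ : E => 1 : C).
Proof.
have e0 : entire (fun k => (k == 0%N)%:R : R).
  by move=> r _; exists 1 => -[|k] /=; rewrite ?normr1 ?mulr1 ?normr0 ?mul0r.
have ez : entire (fun _ : nat => 0 : R) by move=> r _; exists 0 => k; rewrite normr0 mul0r.
have := @is_gck_prof R n (fun=> 1) (fun=> 0) 0 0 (fun k => (k == 0%N)%:R) (fun=> 0) _ _ e0 ez.
rewrite (_ : prof _ _ _ _ = fun=> 1); last first.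
  apply/funext => x; rewrite /prof psum_shift // psum_eq0 // mulr0 addr0 !mulr1.
  by rewrite mul0r scale0r addr0 scale1r.
rewrite /= !mulr1 scale1r !mul0r; apply.
- by move=> k; rewrite mul0r mulr0.
- by move=> k; rewrite /pseries_diffs /= !mulr0.
Qed.

(* The coefficients solving the recurrence of [is_gck_prof]. *)
Fixpoint gck_coef (ka : R) k : R :=
  if k is j.+1 then - ka * gck_coef ka j / (2 * j.+1%:R * (2 * j%:R + n%:R)) else 1.

Lemma affine_neq0 k : 2 * k%:R + n%:R != 0 :> R.
Proof.
rewrite -natrM -natrD pnatr_eq0 addn_eq0 negb_and; apply/orP; right.
by rewrite -lt0n (leq_trans _ (ltn_ord i0)).
Qed.

(** Each denominator is at least [k.+1], so the coefficients are dominated by [|ka| ^ k / k!]. *)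
Lemma gck_coef_entire ka : entire (gck_coef ka).
Proof.
apply: entire_le (entire_inv_fact `|ka|) => k.
rewrite [leRHS]ger0_norm ?divr_ge0 ?exprn_ge0 //.
elim: k => [|k IH]; first by rewrite /= normr1 expr0 fact0 divr1.
rewrite /= normrM normfV normrM normrN exprS factS natrM.
have k0 : 0 < k.+1%:R :> R by rewrite ltr0n.
have n1 : 1 <= n%:R :> R by rewrite ler1n (leq_trans _ (ltn_ord i0)).
have kk : 0 <= k%:R :> R by [].
have d1 : k.+1%:R <= `|2 * k.+1%:R * (2 * k%:R + n%:R) : R|.
  rewrite ger0_norm ?mulr_ge0 ?addr_ge0 //.
  by rewrite [2 * _]mulrC -mulrA ler_peMr ?(ltW k0) //; lra.
have d0 := lt_le_trans k0 d1.
rewrite ler_pdivrMr // (le_trans (ler_wpM2l (normr_ge0 ka) IH)) //.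
have f0 : 0 < k`!%:R :> R by rewrite ltr0n fact_gt0.
rewrite (_ : `|ka| * `|ka| ^+ k / (k.+1%:R * k`!%:R) * _ =
  `|ka| * (`|ka| ^+ k / k`!%:R) * (`|2 * k.+1%:R * (2 * k%:R + n%:R)| / k.+1%:R)); last first.
  by field; rewrite !gt_eqF // nat1r.
rewrite ler_peMr ?mulr_ge0 ?invr_ge0 ?exprn_ge0 //.
by rewrite ler_pdivlMr // mul1r.
Qed.

(** Eliminating [q] from the two coefficient equations of [is_gck_prof] leaves the recursion of
    [gck_coef] with [ka = la * mu]. *)
Lemma is_gck_pair (ta si : R -> R) (la mu : R) : la != 0 ->
  (forall t : R, is_derive t 1 ta (mu * si t)) ->
  (forall t : R, is_derive t 1 si (la * ta t)) ->
  exists F : E -> C, is_gck setT (fun t => (ta t)%:A) F.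
Proof.
move=> la0 dta dsi.
pose c := gck_coef (la * mu); pose q k := mu * c k / (2 * k%:R + n%:R).
have ec : entire c by exact: gck_coef_entire.
have eq_ : entire q.
  apply: entire_le (entireZ mu ec) => k; rewrite /q normrM ler_piMr //.
  rewrite normfV invf_le1 ?normr_gt0 ?affine_neq0 // ger0_norm ?addr_ge0 ?mulr_ge0 //.
  by rewrite -natrM -natrD ler1n (leq_trans _ (leq_addl _ _)) // (leq_trans _ (ltn_ord i0)).
exists (prof ta si c q).
rewrite (_ : (fun t => _) = fun t => (ta t * c 0%N)%:A); last first.
  by apply/funext => t; rewrite /c /= mulr1.
apply: is_gck_prof dta dsi ec eq_ _ _ => k; have a0 := affine_neq0 k.
  by rewrite /q; field.
rewrite /pseries_diffs /q /c /=; field.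
by rewrite a0 nat1r pnatr_eq0.
Qed.

Lemma gck_pythagoras (e g : R) (ta si : R -> R) (FC FS : E -> C) x : e * e = 1 ->
  (forall t : R, is_derive t 1 ta (- e * si t)) -> (forall t : R, is_derive t 1 si (ta t)) ->
  (forall t, ta t * ta t + e * (si t * si t) = 1) ->
  (forall t, FC (realpoint n t) = (ta t * g)%:A) ->
  (forall t, FS (realpoint n t) = (si t * g)%:A) ->
  gck_prod setT FC FC x + e *: gck_prod setT FS FS x = (g ^+ 2)%:A.
Proof.
move=> e2 dta dsi pyt FCE FSE.
(* These are the functions at the double argument, [ta (2 t)] and [si (2 t)], introduced by their
   duplication formulas so that only the derivatives are needed. *)
pose ta2 t := ta t * ta t - e * (si t * si t); pose si2 t := 2 * (si t * ta t).
have dta2 (t : R) : is_derive t 1 ta2 (- (2 * e) * si2 t).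
  have := is_deriveB (is_derive_mul (dta t) (dta t)) (is_deriveZ e (is_derive_mul (dsi t) (dsi t))).
  rewrite [X in is_derive _ _ _ X -> _](_ : _ = - (2 * e) * si2 t) //.
  by rewrite /si2 /GRing.scale /=; ring.
have dsi2 (t : R) : is_derive t 1 si2 (2 * ta2 t).
  have := is_deriveZ (2 : R) (is_derive_mul (dsi t) (dta t)).
  rewrite [X in is_derive _ _ _ X -> _](_ : _ = 2 * ta2 t) //.
  by rewrite /ta2 /GRing.scale /=; ring.
have [|K2 gK2] := is_gck_pair _ dta2 dsi2; first by rewrite pnatr_eq0.
have gC : is_gck setT (fun t => FC (realpoint n t) * FC (realpoint n t))
    (fun x => (g ^+ 2 / 2) *: 1 + (g ^+ 2 / 2) *: K2 x).
  rewrite (_ : (fun t => _) = fun t => (g ^+ 2 / 2) *: 1 + (g ^+ 2 / 2) *: (ta2 t)%:A).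
    exact: is_gck_lin is_gck_one gK2.
  apply/funext => t; rewrite FCE mulr_algl !scalerA -scalerDl; congr (_ *: _).
  transitivity (g ^+ 2 / 2 * (ta t * ta t + e * (si t * si t)) + g ^+ 2 / 2 * ta2 t).
    by rewrite /ta2; field.
  by rewrite pyt mulr1.
(* Since [e * e = 1], the Pythagorean relation gives [si t ^ 2 = e * (1 - ta2 t) / 2]. *)
have gS : is_gck setT (fun t => FS (realpoint n t) * FS (realpoint n t))
    (fun x => (e * (g ^+ 2 / 2)) *: 1 + (- e * (g ^+ 2 / 2)) *: K2 x).
  rewrite (_ : (fun t => _) =
      fun t => (e * (g ^+ 2 / 2)) *: 1 + (- e * (g ^+ 2 / 2)) *: (ta2 t)%:A).
    exact: is_gck_lin is_gck_one gK2.
  apply/funext => t; rewrite FSE mulr_algl !scalerA -scalerDl; congr (_ *: _).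
  transitivity (e * (g ^+ 2 / 2) * (ta t * ta t + e * (si t * si t))
      + - e * (g ^+ 2 / 2) * ta2 t); last by rewrite pyt mulr1.
  by rewrite -[LHS]mul1r -[X in X * _ = _]e2 /ta2; field.
rewrite /gck_prod (gck_eq x gC) (gck_eq x gS) scalerDr !scalerA.
have -> : e * (e * (g ^+ 2 / 2)) = g ^+ 2 / 2 by rewrite mulrA e2 mul1r.
have -> : e * (- e * (g ^+ 2 / 2)) = - (g ^+ 2 / 2) by rewrite mulNr mulrN mulrA e2 mul1r.
by apply: cl_ext => A; rewrite !(cl_coefD, cl_coefZ); field.
Qed.

End GckProducts.

(** * Values on the real axis *)

Section FueterSceValues.
Variables (R : realType) (m : nat).
Local Notation n := m.*2.+1.
Local Notation C := (clifford R n).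
Local Notation E := 'rV[R]_n.+1.
Variables (e : R) (ta si : R -> R).
Hypothesis e2 : e * e = 1.
Hypothesis dta : forall t : R, is_derive t 1 ta (- e * si t).
Hypothesis dsi : forall t : R, is_derive t 1 si (ta t).
Hypothesis ta0 : ta 0 = 1.
Hypothesis si0 : si 0 = 0.

Let g : R := e ^+ m * (4 ^+ m * m`!%:R * m`!%:R / m.*2`!%:R).

(** Stated for any [ta1] with [ta1'' = - e * ta1], so that it covers the cosine type with [ta] and
    the sine type with [si]; both have [ccoef] as scalar coefficients. *)
Lemma fueter_sce_prof (ta1 dta1 : R -> R) (f dta2 : R -> R) q :
  (forall t : R, is_derive t 1 ta1 (dta1 t)) -> (forall t : R, is_derive t 1 dta1 (- e * ta1 t)) ->
  (forall t : R, is_derive t 1 f (dta2 t)) -> (forall t : R, is_derive t 1 dta2 (- e * f t)) ->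
  entire q ->
  forall t, fueter_sce (@prof R n ta1 f (ccoef e) q) (realpoint n t) = (ta1 t * g)%:A.
Proof.
move=> d1 d2 d3 d4 eq_ t; rewrite /fueter_sce /= doubleK.
have [q' _ ->] := iter_laplacian_prof n m d1 d2 d3 d4 (ccoef_entire e2) eq_.
rewrite prof_realpoint; last exact/iter_lap_entire/ccoef_entire.
rewrite (iter_lap_ccoef _ _ (erefl n)) // add0n ffactnn fact0 mul1r.
by rewrite /g.
Qed.

Lemma fueter_sce_cos (F : E -> C) (a : nat -> R) :
  (forall k, a k = (- e) ^+ k / k.*2`!%:R) ->
  (forall x, F x = limn (series (fun k => a k *: paravector x ^+ k.*2))) ->
  forall t, fueter_sce F (realpoint n t) = (ta t * g)%:A.
Proof.
move=> /funext -> FE.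
have -> : F = prof ta si (ccoef e) (fun k => - e * scoef e k).
  by apply/funext => x; rewrite FE; apply: cvg_lim => //; exact: cvg_cos_series.
apply: (@fueter_sce_prof _ (fun t => - e * si t) _ ta) => //.
exact/entireZ/scoef_entire.
Qed.

Lemma fueter_sce_sin (F : E -> C) (a : nat -> R) :
  (forall k, a k = (- e) ^+ k / k.*2.+1`!%:R) ->
  (forall x, F x = limn (series (fun k => a k *: paravector x ^+ k.*2.+1))) ->
  forall t, fueter_sce F (realpoint n t) = (si t * g)%:A.
Proof.
move=> /funext -> FE.
have -> : F = prof si (fun t => - e * ta t) (ccoef e) (fun k => - e * scoef e k).
  by apply/funext => x; rewrite FE; apply: cvg_lim => //; exact: cvg_sin_series.
apply: (@fueter_sce_prof _ ta _ (fun t => - e * (- e * si t))) => //.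
exact/entireZ/scoef_entire.
Qed.

End FueterSceValues.

(** * Real hyperbolic functions and the conclusion *)

Section HyperbolicPair.
Variable R : realType.

Definition coshR (t : R) : R := (expR t + expR (- t)) / 2.
Definition sinhR (t : R) : R := (expR t - expR (- t)) / 2.

Lemma is_derive_coshR (t : R) : is_derive t 1 coshR (sinhR t).
Proof.
have := is_deriveZ (2^-1 : R) (is_deriveD (is_derive_expR t) (is_derive_expRN t)).
rewrite [X in is_derive _ _ _ X -> _](_ : _ = sinhR t); last by rewrite /GRing.scale /= mulrC.
by apply: eq_is_derive_line => h; rewrite /coshR mulrC.
Qed.

Lemma is_derive_sinhR (t : R) : is_derive t 1 sinhR (coshR t).
Proof.
have := is_deriveZ (2^-1 : R) (is_deriveB (is_derive_expR t) (is_derive_expRN t)).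
rewrite [X in is_derive _ _ _ X -> _](_ : _ = coshR t); last first.
  by rewrite /GRing.scale /= opprK mulrC.
by apply: eq_is_derive_line => h; rewrite /sinhR mulrC.
Qed.

Lemma coshR2B (t : R) : coshR t * coshR t - sinhR t * sinhR t = 1.
Proof.
have E : expR t * expR (- t) = 1 by rewrite -expRD subrr expR0.
by rewrite -[RHS]E /coshR /sinhR; field.
Qed.

End HyperbolicPair.

Lemma sqr_signed_power (R : realType) (e : R) m (a : R) : e * e = 1 -> (e ^+ m * a) ^+ 2 = a ^+ 2.
Proof. by move=> e2; rewrite exprMn -exprM mulnC exprM expr2 e2 expr1n mul1r. Qed.

Unset Implicit Arguments.

Theorem lemma3p15 (R : realType) (n : nat) (hn : odd n) (x : 'rV[R]_n.+1) :
  gck_prod [set: 'rV[R]_n.+1] COS COS x + gck_prod [set: 'rV[R]_n.+1] SIN SIN x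
    = ((gamma_const R n ^+ 2)%:A : clifford R n)
  /\
  gck_prod [set: 'rV[R]_n.+1] COSH COSH x - gck_prod [set: 'rV[R]_n.+1] SINH SINH x
    = ((gamma_const R n ^+ 2)%:A : clifford R n).
Proof.
have [m nm] : exists m, n = m.*2.+1 by exists n./2; rewrite -[LHS]odd_double_half hn.
(* The constant carries the sign [(-1) ^ m] while the values on the axis carry [e ^ m]; squaring
   removes the discrepancy. *)
subst n; rewrite gamma_constE sqr_signed_power; last by rewrite mulrNN mulr1.
set g := 4 ^+ m * _ * _ / _.
split.
  have e1 : (1 : R) * 1 = 1 by rewrite mulr1.
  have dc (t : R) : is_derive t 1 (@cos R) (-1 * sin t) by rewrite mulN1r; exact: is_derive_cos.
  have ds (t : R) : is_derive t 1 (@sin R) (cos t) by exact: is_derive_sin.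
  have Cv t : COS (realpoint m.*2.+1 t) = (cos t * (1 ^+ m * g))%:A.
    by apply: (fueter_sce_cos e1 dc ds (@cos0 R) (@sin0 R)) => [k|y]; reflexivity.
  have Sv t : SIN (realpoint m.*2.+1 t) = (sin t * (1 ^+ m * g))%:A.
    by apply: (fueter_sce_sin e1 dc ds (@cos0 R) (@sin0 R)) => [k|y]; reflexivity.
  rewrite -[X in _ + X]scale1r (gck_pythagoras ord0 x e1 dc ds _ Cv Sv) ?sqr_signed_power // => t.
  by rewrite mul1r -!expr2 cos2Dsin2.
have e1 : (-1 : R) * -1 = 1 by rewrite mulrNN mulr1.
have dc (t : R) : is_derive t 1 (@coshR R) (- -1 * sinhR t).
  by rewrite opprK mul1r; exact: is_derive_coshR.
have ds := @is_derive_sinhR R.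
have ch0 : coshR (0 : R) = 1 by rewrite /coshR oppr0 expR0; field.
have sh0 : sinhR (0 : R) = 0 by rewrite /sinhR oppr0 subrr mul0r.
have Cv t : COSH (realpoint m.*2.+1 t) = (coshR t * ((-1) ^+ m * g))%:A.
  (* For [e = -1] the factor [(- e) ^ k] is 1; the sequence [a] is given in the sign-free form of
     the hyperbolic series. *)
  apply: (fueter_sce_cos (a := fun k => (k.*2`!%:R)^-1) e1 dc ds ch0 sh0) => [k|y] //.
  by rewrite opprK expr1n mul1r.
have Sv t : SINH (realpoint m.*2.+1 t) = (sinhR t * ((-1) ^+ m * g))%:A.
  apply: (fueter_sce_sin (a := fun k => (k.*2.+1`!%:R)^-1) e1 dc ds ch0 sh0) => [k|y] //.
  by rewrite opprK expr1n mul1r.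
rewrite -scaleN1r (gck_pythagoras ord0 x e1 dc ds _ Cv Sv) ?sqr_signed_power // => t.
by rewrite mulN1r coshR2B.
Qed.
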